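(* Let $R>0$. A closed curve on the sphere of radius $R$ in $\mathbb{R}^3$ with constant geodesic curvature $\kappa_g=\frac{\sqrt2}{2R}$ is an equi-centro-affine maximal curve on the sphere.
   Context: Curves on the sphere $\mathbb{S}^2(R)$ have nowhere vanishing geodesic curvature, with unit normal $\boldsymbol\epsilon$ (tangent to the sphere) chosen so that $\nabla_{\mathbf T}\mathbf T=\kappa_g\boldsymbol\epsilon$, $\kappa_g>0$; $\mathbf T$ is the unit tangent, $s$ the Euclidean arc length. The equi-centro-affine arc length is ${}^{ec}L=R^{1/3}\int\kappa_g^{1/3}\,ds$. Variations are smooth families of closed curves on the sphere with $\partial_t\mathbf{x}=W\mathbf T+U\boldsymbol\epsilon$. A closed curve of constant geodesic curvature (at $t=t_0$), with Euclidean length $L_e$, is called equi-centro-affine maximal if ${}^{ec}L'(t_0)=0$ for every variation and ${}^{ec}L''(t_0)<0$ for every variation whose normal speed $U$ at $t_0$ is not of the form $a\cos\frac{2\pi s}{L_e}+b\sin\frac{2\pi s}{L_e}$ with $a,b\in\mathbb{R}$ (those excluded are generated by rotations of the sphere).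
   Formalization: The closed curve is assumed simple (traversed once): for a circle covered m ≥ 2 times, rotations of the sphere have normal speed of frequency m, which is not among the excluded speeds, and give second derivative 0, so the claim fails there. *)

(* Defs.v *)
From Stdlib Require Export Reals.
From Coquelicot Require Export Coquelicot.

Open Scope R_scope.

Definition vec3 : Type := (R * R * R)%type.

Definition px (v : vec3) : R := fst (fst v).
Definition py (v : vec3) : R := snd (fst v).
Definition pz (v : vec3) : R := snd v.

Definition vadd (v w : vec3) : vec3 := (px v + px w, py v + py w, pz v + pz w).
Definition vscal (a : R) (v : vec3) : vec3 := (a * px v, a * py v, a * pz v).
Definition vdot (v w : vec3) : R := px v * px w + py v * py w + pz v * pz w.
Definition vnorm (v : vec3) : R := sqrt (vdot v v).

(* As [Derive], this is total, and meaningful where the components are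
   differentiable. *)
Definition vDerive (f : R -> vec3) (u : R) : vec3 :=
  (Derive (fun z => px (f z)) u,
   Derive (fun z => py (f z)) u,
   Derive (fun z => pz (f z)) u).

Definition smooth_curve (c : R -> vec3) : Prop :=
  forall (n : nat) (u : R),
    ex_derive_n (fun z => px (c z)) n u /\
    ex_derive_n (fun z => py (c z)) n u /\
    ex_derive_n (fun z => pz (c z)) n u.

(* Joint smoothness in (t, u) on the strip |t - t0| < delta: [ex_diff_n f n]
   at every point says that all mixed partial derivatives of f up to order n
   exist and are jointly continuous. *)
Definition smooth_family (t0 delta : R) (x : R -> R -> vec3) : Prop :=
  forall (n : nat) (t u : R), Rabs (t - t0) < delta ->
    ex_diff_n (fun t' u' => px (x t' u')) n t u /\
    ex_diff_n (fun t' u' => py (x t' u')) n t u /\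
    ex_diff_n (fun t' u' => pz (x t' u')) n t u.

(* A curve is given by an arbitrary regular parametrization c : R -> vec3;
   a closed one is P-periodic, one turn being the parameter interval [0, P]. *)

Definition speed (c : R -> vec3) (u : R) : R := vnorm (vDerive c u).

Definition d_ds (c f : R -> vec3) (u : R) : vec3 :=
  vscal (/ speed c u) (vDerive f u).

Definition tangent (c : R -> vec3) : R -> vec3 := d_ds c c.

Definition arclength (c : R -> vec3) (u : R) : R := RInt (speed c) 0 u.

Definition euclidean_length (P : R) (c : R -> vec3) : R := arclength c P.

(* nabla_T T on the sphere of radius rho centred at the origin: the part of
   dT/ds orthogonal to the unit normal c / rho of the sphere. *)
Definition nabla_T_T (rho : R) (c : R -> vec3) (u : R) : vec3 :=
  let a := d_ds c (tangent c) u in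
  vadd a (vscal (- (vdot a (c u) / rho ^ 2)) (c u)).

(* The normalization nabla_T T = kappa_g epsilon with kappa_g > 0 and
   |epsilon| = 1 forces the next two formulas. *)
Definition geodesic_curvature (rho : R) (c : R -> vec3) (u : R) : R :=
  vnorm (nabla_T_T rho c u).

Definition unit_normal (rho : R) (c : R -> vec3) (u : R) : vec3 :=
  vscal (/ geodesic_curvature rho c u) (nabla_T_T rho c u).

Record closed_sphere_curve (rho P : R) (c : R -> vec3) : Prop := {
  csc_period_pos : 0 < P;
  csc_smooth : smooth_curve c;
  csc_periodic : forall u, c (u + P) = c u;
  csc_on_sphere : forall u, vnorm (c u) = rho;
  csc_regular : forall u, 0 < speed c u;
  csc_curved : forall u, 0 < geodesic_curvature rho c u
}.

(* No self-intersection; in particular [0, P] is a single turn.  For a circle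
   covered m >= 2 times the rotations of the sphere would have normal speed of
   frequency m, not the frequency 1 of [rotational_speed] below. *)
Definition simple_curve (P : R) (c : R -> vec3) : Prop :=
  forall u v, 0 <= u < P -> 0 <= v < P -> c u = c v -> u = v.

Definition ec_length (rho P : R) (c : R -> vec3) : R :=
  Rpower rho (1 / 3) *
  RInt (fun u => Rpower (geodesic_curvature rho c u) (1 / 3) * speed c u) 0 P.

(* x t is the curve at time t, |t - t0| < delta; W and U are its tangential
   and normal speeds. *)
Record variation (rho P : R) (c : R -> vec3) (t0 delta : R)
    (x : R -> R -> vec3) (W U : R -> R -> R) : Prop := {
  var_delta_pos : 0 < delta;
  var_initial : forall u, x t0 u = c u;
  var_smooth : smooth_family t0 delta x;
  var_closed : forall t, Rabs (t - t0) < delta -> closed_sphere_curve rho P (x t);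
  var_velocity : forall t u, Rabs (t - t0) < delta ->
    vDerive (fun t' => x t' u) t =
    vadd (vscal (W t u) (tangent (x t) u))
         (vscal (U t u) (unit_normal rho (x t) u))
}.

Definition rotational_speed (P : R) (c : R -> vec3) (V : R -> R) : Prop :=
  let Le := euclidean_length P c in
  exists a b : R, forall u,
    V u = a * cos (2 * PI * arclength c u / Le)
        + b * sin (2 * PI * arclength c u / Le).

(* [is_derive] and [is_derive_n] carry the existence of the derivatives, and
   the [locally] clause makes the total [Derive] inside [is_derive_n _ 2]
   the actual first derivative near t0. *)
Definition ec_maximal (rho P : R) (c : R -> vec3) : Prop :=
  closed_sphere_curve rho P c /\
  (exists k : R, forall u, geodesic_curvature rho c u = k) /\
  forall (t0 delta : R) (x : R -> R -> vec3) (W U : R -> R -> R),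
    variation rho P c t0 delta x W U ->
    let L := fun t => ec_length rho P (x t) in
    is_derive L t0 0 /\
    (~ rotational_speed P c (U t0) ->
     locally t0 (fun t => ex_derive L t) /\
     exists l : R, is_derive_n L 2 t0 l /\ l < 0).

(* Main.v *)
Require Import Defs.
From Stdlib Require Import Lra Psatz FunctionalExtensionality ClassicalEpsilon Ranalysis5.

(* The equi-centro-affine length element is |det (x, x_u, x_uu)|^(1/3) du.  Expanding
   the determinant of the varied curve in the Frenet frame (c, T, E) of a circle with
   2 k^2 = 1 / rho^2 shows that the first variation integrates a total derivative, and
   that the second variation is, up to total derivatives and a positive factor,
   - int (U_ss^2 - 9 k^2 U_s^2 + 18 k^4 U^2) ds.  In the angle theta = sqrt 3 k s, which
   increases by 2 pi over a simple turn, this is a multiple of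
   - int (U''^2 - 3 U'^2 + 2 U^2) dtheta, of weight - (n^2 - 1) (n^2 - 2) on the n-th
   Fourier mode: negative except for n = 1, -1.  Positivity is proved without Fourier
   series, by Wirtinger's inequality on the half-period applied to the parts of U that
   are even and odd under theta -> theta + pi. *)

(** * Smooth periodic functions *)

(** The value of the curvature comes from the first variation. On a circle of geodesic curvature k
    on the sphere of radius rho, with velocity W T + U E, the determinant changes at the relative
    rate (U_ss + 3 k W_s + (1 / rho^2 - 2 k^2) U) / k; the undifferentiated U drops out exactly when
    2 k^2 = 1 / rho^2. The curvature of the circle in space is then sqrt (k^2 + 1 / rho^2) = sqrt 3
    k, the rate of theta. Since the determinant is polynomial in the derivatives of the curve, it is
    differentiated in time without following the frames of the neighbouring curves. The acceleration
    is arbitrary apart from its component along c, but it enters linearly and, the circle being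
    critical, its free components contribute only total derivatives. In the quadratic form,
    Wirtinger's inequality on a full period would give int U''^2 >= int U'^2, whereas the factor 3
    is needed. On the half-period the constant is 4; the first harmonics, on which the form
    vanishes, are projected out beforehand. *)

Fixpoint smooth_upto (n : nat) (f : R -> R) : Prop :=
  match n with
  | O => True
  | S m => (forall u, ex_derive f u) /\ smooth_upto m (Derive f)
  end.

(** Recursing on [Derive f] lets the product and chain rules close an induction on the order without
    a Leibniz formula; [smooth_of_ex_derive_n] translates from iterated derivatives. *)
Definition smooth (f : R -> R) : Prop := forall n, smooth_upto n f.

Lemma smooth_upto_S (n : nat) (f : R -> R) : smooth_upto (S n) f -> smooth_upto n f.
Proof.
  revert f; induction n as [|n IH]; intros f; [easy|].
  intros [H1 H2]; split; [exact H1 | exact (IH _ H2)].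
Qed.

Lemma smooth_ex_derive (f : R -> R) (u : R) : smooth f -> ex_derive f u.
Proof. intros H; exact (proj1 (H 1%nat) u). Qed.

Lemma smooth_Derive (f : R -> R) : smooth f -> smooth (Derive f).
Proof. intros H n; exact (proj2 (H (S n))). Qed.

Lemma smooth_is_derive (f : R -> R) (u : R) : smooth f -> is_derive f u (Derive f u).
Proof. intros H; apply Derive_correct, smooth_ex_derive, H. Qed.

Lemma smooth_continuous (f : R -> R) (u : R) : smooth f -> continuous f u.
Proof. intros H; apply (ex_derive_continuous f), smooth_ex_derive, H. Qed.

Lemma smooth_ex_RInt (f : R -> R) (a b : R) : smooth f -> ex_RInt f a b.
Proof. intros H; apply (ex_RInt_continuous f); intros; apply smooth_continuous, H. Qed.

Lemma smooth_const (a : R) : smooth (fun _ => a).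
Proof.
  intros n; revert a; induction n as [|n IH]; intros a; [easy|].
  split; [intros u; apply ex_derive_const|].
  replace (Derive (fun _ => a)) with (fun _ : R => 0); [apply IH|].
  extensionality u; now rewrite Derive_const.
Qed.

Lemma smooth_upto_plus (n : nat) (f g : R -> R) :
  smooth_upto n f -> smooth_upto n g -> smooth_upto n (fun u => f u + g u).
Proof.
  revert f g; induction n as [|n IH]; intros f g; [easy|].
  intros [Hf Hf'] [Hg Hg']; split.
  - intros u; apply (ex_derive_plus f g); auto.
  - replace (Derive (fun u => f u + g u)) with (fun u => Derive f u + Derive g u); [auto|].
    extensionality u; now rewrite Derive_plus.
Qed.

Lemma smooth_upto_mult (n : nat) (f g : R -> R) :
  smooth_upto n f -> smooth_upto n g -> smooth_upto n (fun u => f u * g u).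
Proof.
  revert f g; induction n as [|n IH]; intros f g; [easy|].
  intros Hf Hg; split.
  - intros u; apply ex_derive_mult; [apply Hf | apply Hg].
  - replace (Derive (fun u => f u * g u))
      with (fun u => Derive f u * g u + f u * Derive g u).
    + apply smooth_upto_plus; apply IH;
        solve [apply Hf | apply Hg | now apply smooth_upto_S].
    + extensionality u; rewrite Derive_mult; [easy | apply Hf | apply Hg].
Qed.

Lemma smooth_plus (f g : R -> R) : smooth f -> smooth g -> smooth (fun u => f u + g u).
Proof. intros Hf Hg n; now apply smooth_upto_plus. Qed.

Lemma smooth_mult (f g : R -> R) : smooth f -> smooth g -> smooth (fun u => f u * g u).
Proof. intros Hf Hg n; now apply smooth_upto_mult. Qed.

Lemma smooth_opp (f : R -> R) : smooth f -> smooth (fun u => - f u).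
Proof.
  intros H; replace (fun u => - f u) with (fun u => -1 * f u).
  - apply smooth_mult; [apply smooth_const | exact H].
  - extensionality u; ring.
Qed.

Lemma smooth_minus (f g : R -> R) : smooth f -> smooth g -> smooth (fun u => f u - g u).
Proof. intros; unfold Rminus; apply smooth_plus; [|apply smooth_opp]; auto. Qed.

Lemma smooth_inv (f : R -> R) : (forall u, f u <> 0) -> smooth f -> smooth (fun u => / f u).
Proof.
  intros Hnz Hf n; induction n as [|n IH]; [easy|split].
  - intros u; apply ex_derive_inv; [now apply smooth_ex_derive | apply Hnz].
  - replace (Derive (fun u => / f u)) with (fun u => - Derive f u * (/ f u * / f u)).
    + repeat apply smooth_upto_mult; auto.
      now apply smooth_opp, smooth_Derive.
    + extensionality u; rewrite Derive_inv; [|now apply smooth_ex_derive | apply Hnz].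
      field; apply Hnz.
Qed.

(** Writing 1 / sqrt f as sqrt f / f makes the root itself recur in its derivative, so that the
    induction on the order closes; [smooth_inv] closes in the same way. *)
Lemma smooth_sqrt (f : R -> R) : (forall u, 0 < f u) -> smooth f -> smooth (fun u => sqrt (f u)).
Proof.
  intros Hpos Hf n; induction n as [|n IH]; [easy|].
  assert (Hd : forall u, is_derive (fun u => sqrt (f u)) u
      (Derive f u * (/ 2 * (sqrt (f u) * / f u)))).
  { intros u. assert (0 < sqrt (f u)) by apply sqrt_lt_R0, Hpos.
    assert (E : f u = sqrt (f u) * sqrt (f u)) by (rewrite sqrt_sqrt; [easy | apply Rlt_le, Hpos]).
    evar_last.
    - apply is_derive_sqrt; [now apply smooth_is_derive | apply Hpos].
    - revert E H; generalize (sqrt (f u)); intros s E H.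
      rewrite E; field; lra. }
  split.
  - intros u; eexists; apply Hd.
  - replace (Derive (fun u => sqrt (f u)))
      with (fun u => Derive f u * (/ 2 * (sqrt (f u) * / f u))).
    + repeat apply smooth_upto_mult; auto.
      * now apply smooth_Derive.
      * apply smooth_const.
      * apply smooth_inv; [|easy]; intros u; apply Rgt_not_eq, Hpos.
    + extensionality u; symmetry; apply is_derive_unique, Hd.
Qed.

Lemma is_derive_shift (f : R -> R) (a u : R) :
  smooth f -> is_derive (fun z => f (z + a)) u (Derive f (u + a)).
Proof.
  intros H; evar_last.
  - apply (is_derive_comp f (fun z => z + a)); [now apply smooth_is_derive|].
    apply (is_derive_plus (fun z => z) (fun _ => a));
      [apply (is_derive_id (K := R_AbsRing)) | apply (is_derive_const (K := R_AbsRing))].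
  - unfold scal, plus, one, zero; simpl; unfold mult; simpl; ring.
Qed.

Lemma Derive_shift (f : R -> R) (a u : R) :
  smooth f -> Derive (fun z => f (z + a)) u = Derive f (u + a).
Proof. intros H; now apply is_derive_unique, is_derive_shift. Qed.

Lemma smooth_shift (f : R -> R) (a : R) : smooth f -> smooth (fun u => f (u + a)).
Proof.
  intros H n; revert f H; induction n as [|n IH]; intros f H; [easy|split].
  - intros u; eexists; now apply is_derive_shift.
  - replace (Derive (fun u => f (u + a))) with (fun u => Derive f (u + a)).
    + now apply IH, smooth_Derive.
    + extensionality u; now rewrite Derive_shift.
Qed.

Lemma smooth_cos_sin : smooth cos /\ smooth sin.
Proof.
  enough (H : forall n, smooth_upto n cos /\ smooth_upto n sin) by (split; intros n; apply H).
  induction n as [|n [IHc IHs]]; [easy|].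
  split; split.
  - intros u; eexists; apply is_derive_cos.
  - replace (Derive cos) with (fun u => -1 * sin u).
    + apply smooth_upto_mult; [apply smooth_const | easy].
    + extensionality u; rewrite (is_derive_unique _ _ _ (is_derive_cos u)); ring.
  - intros u; eexists; apply is_derive_sin.
  - replace (Derive sin) with cos; [easy|].
    extensionality u; symmetry; apply is_derive_unique, is_derive_sin.
Qed.

Lemma smooth_of_ex_derive_n (f : R -> R) :
  (forall n u, ex_derive_n f n u) -> smooth f.
Proof.
  intros H. enough (G : forall n m, smooth_upto n (Derive_n f m)) by (intros n; apply (G n 0%nat)).
  induction n as [|n IH]; intros m; [easy|].
  split; [intros u; apply (H (S m) u) | apply (IH (S m))].
Qed.

Definition periodic_smooth (P : R) (f : R -> R) : Prop :=
  smooth f /\ forall u, f (u + P) = f u.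

Lemma periodic_smooth_const (P a : R) : periodic_smooth P (fun _ => a).
Proof. split; [apply smooth_const | easy]. Qed.

Lemma periodic_smooth_plus (P : R) (f g : R -> R) :
  periodic_smooth P f -> periodic_smooth P g -> periodic_smooth P (fun u => f u + g u).
Proof. intros [H1 H2] [H3 H4]; split; [now apply smooth_plus | intros u; now rewrite H2, H4]. Qed.

Lemma periodic_smooth_mult (P : R) (f g : R -> R) :
  periodic_smooth P f -> periodic_smooth P g -> periodic_smooth P (fun u => f u * g u).
Proof. intros [H1 H2] [H3 H4]; split; [now apply smooth_mult | intros u; now rewrite H2, H4]. Qed.

Lemma periodic_smooth_opp (P : R) (f : R -> R) :
  periodic_smooth P f -> periodic_smooth P (fun u => - f u).
Proof. intros [H1 H2]; split; [now apply smooth_opp | intros u; now rewrite H2]. Qed.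

Lemma periodic_smooth_minus (P : R) (f g : R -> R) :
  periodic_smooth P f -> periodic_smooth P g -> periodic_smooth P (fun u => f u - g u).
Proof. intros [H1 H2] [H3 H4]; split; [now apply smooth_minus | intros u; now rewrite H2, H4]. Qed.

Lemma periodic_smooth_inv (P : R) (f : R -> R) :
  (forall u, f u <> 0) -> periodic_smooth P f -> periodic_smooth P (fun u => / f u).
Proof. intros Hnz [H1 H2]; split; [now apply smooth_inv | intros u; now rewrite H2]. Qed.

Lemma periodic_smooth_sqrt (P : R) (f : R -> R) :
  (forall u, 0 < f u) -> periodic_smooth P f -> periodic_smooth P (fun u => sqrt (f u)).
Proof. intros Hnz [H1 H2]; split; [now apply smooth_sqrt | intros u; now rewrite H2]. Qed.

Lemma periodic_smooth_pow (P : R) (f : R -> R) (n : nat) :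
  periodic_smooth P f -> periodic_smooth P (fun u => f u ^ n).
Proof.
  intros H; induction n as [|n IH]; simpl; [apply periodic_smooth_const|].
  now apply periodic_smooth_mult.
Qed.

Lemma periodic_smooth_Derive (P : R) (f : R -> R) :
  periodic_smooth P f -> periodic_smooth P (Derive f).
Proof.
  intros [H1 H2]; split; [now apply smooth_Derive|].
  intros u; rewrite <- Derive_shift by easy. apply Derive_ext; intros t; apply H2.
Qed.

Lemma periodic_smooth_ex_derive (P : R) (f : R -> R) (u : R) :
  periodic_smooth P f -> ex_derive f u.
Proof. intros [H _]; now apply smooth_ex_derive. Qed.

Ltac psmooth :=
  repeat first
    [ assumption
    | apply periodic_smooth_const
    | apply periodic_smooth_plus
    | apply periodic_smooth_minus
    | apply periodic_smooth_opp
    | apply periodic_smooth_mult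
    | apply periodic_smooth_pow
    | match goal with |- periodic_smooth ?P (fun u => Derive ?f u) =>
        change (periodic_smooth P (Derive f)) end; apply periodic_smooth_Derive
    | apply periodic_smooth_Derive ].

(** * Integrals of smooth functions over a period *)

Lemma RInt_Derive_smooth (f : R -> R) (a b : R) :
  smooth f -> RInt (Derive f) a b = f b - f a :> R.
Proof.
  intros H; apply RInt_Derive; intros;
    [now apply smooth_ex_derive | now apply smooth_continuous, smooth_Derive].
Qed.

Lemma RInt_Derive_periodic (P : R) (f : R -> R) (a : R) :
  periodic_smooth P f -> RInt (Derive f) a (a + P) = 0 :> R.
Proof. intros [H1 H2]; rewrite RInt_Derive_smooth by easy; rewrite H2; ring. Qed.

Lemma RInt_periodic (P : R) (f : R -> R) (a : R) :
  periodic_smooth P f -> RInt f a (a + P) = RInt f 0 P :> R.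
Proof.
  intros [H1 H2].
  assert (I : forall a b, ex_RInt f a b) by (intros; now apply smooth_ex_RInt).
  assert (E : RInt f P (a + P) = RInt f 0 a :> R).
  { pose proof (RInt_comp_lin f 1 P 0 a) as HL.
    rewrite Rmult_0_r, Rmult_1_l, Rplus_0_l in HL.
    rewrite <- HL by easy.
    apply RInt_ext; intros x _; unfold scal; simpl; unfold mult; simpl.
    now rewrite !Rmult_1_l, H2. }
  pose proof (RInt_Chasles f 0 a (a + P) (I _ _) (I _ _)) as C1.
  pose proof (RInt_Chasles f 0 P (a + P) (I _ _) (I _ _)) as C2.
  unfold plus in C1, C2; simpl in C1, C2. lra.
Qed.

(** By continuity f exceeds f a / 2 on a short interval to the right of a. The left endpoint
    suffices for periodic integrands, since the period can be started where the integrand is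
    positive. *)
Lemma RInt_pos_of_left (f : R -> R) (a b : R) :
  a < b -> smooth f -> (forall u, 0 <= f u) -> 0 < f a -> 0 < RInt f a b.
Proof.
  intros Hab Hs Hnn Ha.
  assert (Hc : continuity_pt f a) by (apply continuity_pt_filterlim; now apply smooth_continuous).
  destruct (Hc (f a / 2)) as [d [Hd H]]; [lra|].
  set (m := Rmin (a + d / 2) b).
  assert (Hm : a < m <= b) by (unfold m; split; [apply Rmin_glb_lt; lra | apply Rmin_r]).
  assert (Hm' : m <= a + d / 2) by apply Rmin_l.
  rewrite <- (RInt_Chasles f a m b) by now apply smooth_ex_RInt.
  assert (H1 : (m - a) * (f a / 2) <= RInt f a m).
  { replace ((m - a) * (f a / 2)) with (RInt (fun _ => f a / 2) a m)
      by (rewrite RInt_const; reflexivity).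
    apply RInt_le; [lra | apply ex_RInt_const | now apply smooth_ex_RInt |].
    intros x Hx. assert (Hx' : Rabs (f x - f a) < f a / 2).
    { apply H; split; [split; [exact I | lra]|]. simpl; unfold Rdist.
      rewrite Rabs_pos_eq; lra. }
    apply Rabs_def2 in Hx'; lra. }
  assert (H2 : 0 <= RInt f m b) by (apply RInt_ge_0; [lra | now apply smooth_ex_RInt | auto]).
  unfold plus; simpl. assert (0 < (m - a) * (f a / 2)) by (apply Rmult_lt_0_compat; lra). lra.
Qed.

(** * Wirtinger's inequality *)

Lemma RInt_plus_smooth (f g : R -> R) (a b : R) : smooth f -> smooth g ->
  RInt (fun u => f u + g u) a b = RInt f a b + RInt g a b :> R.
Proof. intros Hf Hg; apply (RInt_plus f g); now apply smooth_ex_RInt. Qed.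

Lemma RInt_scal_smooth (f : R -> R) (l a b : R) : smooth f ->
  RInt (fun u => l * f u) a b = l * RInt f a b :> R.
Proof. intros Hf; apply (RInt_scal f); now apply smooth_ex_RInt. Qed.

Lemma RInt_Chasles_smooth (f : R -> R) (a b c : R) : smooth f ->
  RInt f a c = RInt f a b + RInt f b c :> R.
Proof. intros Hf; symmetry; apply (RInt_Chasles f); now apply smooth_ex_RInt. Qed.

Lemma RInt_shift (f : R -> R) (c a b : R) : smooth f ->
  RInt (fun u => f (u + c)) a b = RInt f (a + c) (b + c) :> R.
Proof.
  intros Hf. pose proof (RInt_comp_lin f 1 c a b) as HL.
  rewrite !Rmult_1_l in HL. rewrite <- HL by now apply smooth_ex_RInt.
  apply RInt_ext; intros x _; unfold scal; simpl; unfold mult; simpl.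
  now rewrite !Rmult_1_l.
Qed.

Ltac smooth_tac :=
  repeat first
    [ assumption
    | apply smooth_const
    | apply smooth_plus
    | apply smooth_minus
    | apply smooth_opp
    | apply smooth_mult
    | match goal with |- smooth (fun u => Derive ?f u) => change (smooth (Derive f)) end;
      apply smooth_Derive
    | apply smooth_Derive
    | exact (proj1 smooth_cos_sin)
    | exact (proj2 smooth_cos_sin) ].

(* With t = tan (w (x - m)), the square (f' + w t f)^2 equals
   f'^2 - w^2 f^2 + (w t f^2)', and t stays finite as w < pi / (b - a). *)
Lemma wirtinger_dirichlet_lt (f : R -> R) (a b w : R) :
  smooth f -> a < b -> 0 < w -> w * (b - a) < PI -> f a = 0 -> f b = 0 ->
  w ^ 2 * RInt (fun x => f x * f x) a b <= RInt (fun x => Derive f x * Derive f x) a b.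
Proof.
  intros Hf Hab Hw HwP Ha Hb.
  set (m := (a + b) / 2).
  (* Only the Riccati equation of the tangent is kept. Measured from the midpoint m, the argument
     stays strictly between - pi / 2 and pi / 2, where the cosine is positive. *)
  assert (Ht : exists t : R -> R, forall x, a <= x <= b -> is_derive t x (w * (1 + t x ^ 2))).
  { exists (fun x => sin (w * (x - m)) / cos (w * (x - m))); intros x Hx.
    assert (Hcos : 0 < cos (w * (x - m))) by (unfold m; apply cos_gt_0; nra).
    evar_last.
    - apply (is_derive_div (fun x => sin (w * (x - m))) (fun x => cos (w * (x - m))));
        [auto_derive; [easy | reflexivity] | auto_derive; [easy | reflexivity] | lra].
    - simpl; change (x + - m) with (x - m); field; lra. }
  destruct Ht as [t Ht].
  set (F := fun x => w * (f x * f x) * t x).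
  set (dF := fun x => 2 * w * f x * Derive f x * t x
     + w ^ 2 * (f x * f x) * (1 + t x ^ 2)).
  assert (Htd : forall x, a <= x <= b -> ex_derive t x) by (intros; eexists; now apply Ht).
  assert (HF : is_RInt dF a b (minus (F b) (F a))).
  { apply (is_RInt_derive F dF); intros x Hx; rewrite Rmin_left, Rmax_right in Hx by lra.
    - unfold F, dF. assert (ex_derive f x) by now apply smooth_ex_derive.
      auto_derive; [auto|].
      change (Derive (fun x => f x) x) with (Derive f x).
      change (Derive (fun x => t x) x) with (Derive t x).
      rewrite (is_derive_unique _ _ _ (Ht x Hx)); ring.
    - apply (ex_derive_continuous dF).
      unfold dF. assert (ex_derive f x) by now apply smooth_ex_derive.
      assert (ex_derive (Derive f) x) by now apply smooth_ex_derive, smooth_Derive.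
      revert H0; generalize (Derive f); intros g Hg.
      assert (ex_derive t x) by now apply Htd.
      auto_derive; repeat split; assumption. }
  assert (HI : RInt dF a b = 0 :> R).
  { rewrite (is_RInt_unique _ _ _ _ HF). unfold F, minus, plus, opp; simpl.
    rewrite Ha, Hb; ring. }
  assert (Hex : ex_RInt dF a b) by (eexists; apply HF).
  assert (Hsm : smooth (fun x => Derive f x * Derive f x + - w ^ 2 * (f x * f x)))
    by smooth_tac.
  assert (H : 0 <= RInt (fun x => (Derive f x * Derive f x + - w ^ 2 * (f x * f x)) + dF x) a b).
  { apply RInt_ge_0; [lra| |].
    - apply (ex_RInt_plus (fun x => Derive f x * Derive f x + - w ^ 2 * (f x * f x)) dF);
        [now apply smooth_ex_RInt | easy].
    - intros x Hx.
      replace (Derive f x * Derive f x + - w ^ 2 * (f x * f x) + dF x)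
        with ((Derive f x + w * t x * f x) ^ 2)
        by (unfold dF; ring).
      apply pow2_ge_0. }
  rewrite (RInt_plus (fun x => Derive f x * Derive f x + - w ^ 2 * (f x * f x)) dF) in H
    by (try easy; now apply smooth_ex_RInt).
  unfold plus in H; simpl in H. rewrite HI in H.
  rewrite RInt_plus_smooth, RInt_scal_smooth in H by smooth_tac.
  lra.
Qed.

(** This is the limit w -> pi / (b - a), at which the tangent blows up at both ends. A failure of
    the inequality would leave a gap, still visible at w = pi (1 - e) / (b - a) for small e. *)
Lemma wirtinger_dirichlet (f : R -> R) (a b : R) :
  smooth f -> a < b -> f a = 0 -> f b = 0 ->
  PI ^ 2 * RInt (fun x => f x * f x) a b
    <= (b - a) ^ 2 * RInt (fun x => Derive f x * Derive f x) a b.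
Proof.
  intros Hf Hab Ha Hb.
  assert (HP := PI_RGT_0).
  assert (HI : 0 <= RInt (fun x => f x * f x) a b).
  { apply RInt_ge_0; [lra | apply smooth_ex_RInt; smooth_tac | intros; nra]. }
  set (I := RInt (fun x => f x * f x) a b) in *.
  set (J := RInt (fun x => Derive f x * Derive f x) a b).
  apply Rnot_lt_le; intros Hlt.
  (* Passing from e = 0 to e costs pi^2 I (2 e - e^2) <= 2 pi^2 I e, less than the assumed gap for
     this e. The bound 1 / 2 keeps w positive, and I + 1 keeps the denominator away from 0. *)
  set (e := Rmin (1 / 2) ((PI ^ 2 * I - (b - a) ^ 2 * J) / (4 * PI ^ 2 * (I + 1)))).
  assert (HP2 : 0 < PI ^ 2) by nra.
  assert (He : 0 < e <= 1 / 2).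
  { split; [|apply Rmin_l]. apply Rmin_glb_lt; [lra|].
    apply Rdiv_lt_0_compat; nra. }
  assert (He2 : 4 * PI ^ 2 * (I + 1) * e <= PI ^ 2 * I - (b - a) ^ 2 * J).
  { assert (e <= (PI ^ 2 * I - (b - a) ^ 2 * J) / (4 * PI ^ 2 * (I + 1))) by apply Rmin_r.
    apply (Rmult_le_compat_l (4 * PI ^ 2 * (I + 1))) in H; [|nra].
    replace (4 * PI ^ 2 * (I + 1) * ((PI ^ 2 * I - (b - a) ^ 2 * J) / (4 * PI ^ 2 * (I + 1))))
      with (PI ^ 2 * I - (b - a) ^ 2 * J) in H by (field; nra). exact H. }
  pose proof (wirtinger_dirichlet_lt f a b (PI * (1 - e) / (b - a)) Hf Hab) as HW.
  assert (HW1 : 0 < PI * (1 - e) / (b - a)) by (apply Rdiv_lt_0_compat; nra).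
  assert (HW2 : PI * (1 - e) / (b - a) * (b - a) < PI).
  { replace (PI * (1 - e) / (b - a) * (b - a)) with (PI * (1 - e)) by (field; lra). nra. }
  specialize (HW HW1 HW2 Ha Hb). fold I J in HW.
  apply (Rmult_le_compat_l ((b - a) ^ 2)) in HW; [|nra].
  replace ((b - a) ^ 2 * ((PI * (1 - e) / (b - a)) ^ 2 * I))
    with (PI ^ 2 * I - PI ^ 2 * (I * (2 * e - e * e))) in HW by (field; lra).
  assert (PI ^ 2 * (I * (2 * e - e * e)) <= PI ^ 2 * (2 * I * e)).
  { apply Rmult_le_compat_l; [lra|]. nra. }
  assert (0 < PI ^ 2 * (2 * I * e + 4 * e)) by (apply Rmult_lt_0_compat; nra).
  nra.
Qed.

(* Subtracting the value f a = f (a + T / 2) gives Dirichlet conditions on both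
   half-periods, and only increases the square integral of a mean-zero f. *)
Lemma wirtinger_periodic (T : R) (f : R -> R) :
  0 < T -> periodic_smooth T f -> RInt f 0 T = 0 ->
  (2 * PI) ^ 2 * RInt (fun x => f x * f x) 0 T
    <= T ^ 2 * RInt (fun x => Derive f x * Derive f x) 0 T.
Proof.
  intros HT Hp Hmean. pose proof Hp as [Hf Hper].
  (* The difference h x = f (x + T / 2) - f x satisfies h (T / 2) = - h 0 by periodicity, so it has
     a zero. *)
  assert (Hc : exists a, f a = f (a + T / 2)).
  { set (h := fun x => f (x + T / 2) - f x).
    assert (Hh : smooth h) by (apply smooth_minus; [now apply smooth_shift | easy]).
    assert (E : h (T / 2) = - h 0).
    { unfold h. replace (T / 2 + T / 2) with (0 + T) by field.
      rewrite Hper, Rplus_0_l; ring. }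
    destruct (IVT_gen h 0 (T / 2) 0) as [a [_ Ha]].
    - intros x; apply continuity_pt_filterlim; now apply smooth_continuous.
    - rewrite E. unfold Rmin, Rmax; destruct Rle_dec; lra.
    - exists a; unfold h in Ha; lra. }
  destruct Hc as [a Ha].
  set (g := fun x => f x - f a).
  assert (Hg : smooth g) by (unfold g; smooth_tac).
  assert (Dg : Derive g = Derive f).
  { extensionality x; unfold g. rewrite Derive_minus, Derive_const;
      [ring | now apply smooth_ex_derive | apply ex_derive_const]. }
  assert (W1 := wirtinger_dirichlet g a (a + T / 2) Hg ltac:(lra)
                  ltac:(unfold g; lra) ltac:(unfold g; lra)).
  assert (W2 := wirtinger_dirichlet g (a + T / 2) (a + T) Hg ltac:(lra)
                  ltac:(unfold g; lra) ltac:(unfold g; rewrite Hper; lra)).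
  rewrite Dg in W1, W2.
  replace (a + T / 2 - a) with (T / 2) in W1 by ring.
  replace (a + T - (a + T / 2)) with (T / 2) in W2 by field.
  assert (C1 := RInt_Chasles_smooth (fun x => Derive f x * Derive f x) a (a + T / 2) (a + T)
                  ltac:(smooth_tac)).
  assert (C2 := RInt_Chasles_smooth (fun x => g x * g x) a (a + T / 2) (a + T)
                  ltac:(smooth_tac)).
  rewrite (RInt_periodic T (fun x => Derive f x * Derive f x)) in C1 by psmooth.
  rewrite (RInt_periodic T (fun x => g x * g x)) in C2 by (unfold g; psmooth).
  assert (E : RInt (fun x => g x * g x) 0 T
              = RInt (fun x => f x * f x) 0 T + T * (f a * f a) :> R).
  { transitivity (RInt (fun x => f x * f x + (-2 * f a * f x + f a * f a)) 0 T).
    - apply RInt_ext; intros; unfold g; simpl; ring.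
    - rewrite !RInt_plus_smooth, RInt_scal_smooth, Hmean, RInt_const by smooth_tac.
      unfold scal; simpl; unfold mult; simpl; ring. }
  assert (0 <= f a * f a) by nra.
  assert (HP := PI_RGT_0).
  assert (0 <= PI ^ 2 * (T * (f a * f a))) by (apply Rmult_le_pos; nra).
  rewrite E in C2. rewrite C1.
  replace (RInt (fun x => f x * f x) 0 T) with
    (RInt (fun x => g x * g x) a (a + T / 2) + RInt (fun x => g x * g x) (a + T / 2) (a + T)
      - T * (f a * f a)) by lra.
  nra.
Qed.

(** The constant is (2 pi / T)^2 at T = pi; being above 3, it controls the negative term of
    [rotation_form]. *)
Lemma wirtinger_PI (f : R -> R) :
  periodic_smooth PI f -> RInt f 0 PI = 0 ->
  4 * RInt (fun x => f x * f x) 0 PI <= RInt (fun x => Derive f x * Derive f x) 0 PI.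
Proof.
  intros H1 H2. assert (HP := PI_RGT_0).
  pose proof (wirtinger_periodic PI f HP H1 H2) as H.
  apply (Rmult_le_reg_l (PI ^ 2)); nra.
Qed.

(** * The quadratic form on the circle *)

Lemma Derive_smooth_plus (f g : R -> R) : smooth f -> smooth g ->
  Derive (fun u => f u + g u) = (fun u => Derive f u + Derive g u).
Proof. intros; extensionality u; apply Derive_plus; now apply smooth_ex_derive. Qed.

Lemma Derive_smooth_minus (f g : R -> R) : smooth f -> smooth g ->
  Derive (fun u => f u - g u) = (fun u => Derive f u - Derive g u).
Proof. intros; extensionality u; apply Derive_minus; now apply smooth_ex_derive. Qed.

Lemma Derive_smooth_mult (f g : R -> R) : smooth f -> smooth g ->
  Derive (fun u => f u * g u) = (fun u => Derive f u * g u + f u * Derive g u).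
Proof. intros; extensionality u; apply Derive_mult; now apply smooth_ex_derive. Qed.

Lemma Derive_smooth_scal (a : R) (f : R -> R) :
  Derive (fun u => a * f u) = (fun u => a * Derive f u).
Proof. extensionality u; apply Derive_scal. Qed.

Lemma Derive_cos : Derive cos = (fun u => - sin u).
Proof. extensionality u; apply is_derive_unique, is_derive_cos. Qed.

Lemma Derive_sin : Derive sin = cos.
Proof. extensionality u; apply is_derive_unique, is_derive_sin. Qed.

Lemma periodic_smooth_cos_sin : periodic_smooth (2 * PI) cos /\ periodic_smooth (2 * PI) sin.
Proof.
  split; (split; [apply smooth_cos_sin|]); intros u;
    [rewrite <- (cos_period u 1) | rewrite <- (sin_period u 1)]; f_equal; simpl; ring.
Qed.

(** Named after the kernel of its integral over a turn: the span of cos and sin, which are the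
    normal speeds of rotations in the turning angle. *)
Definition rotation_form (f : R -> R) (x : R) : R :=
  Derive (Derive f) x * Derive (Derive f) x - 3 * (Derive f x * Derive f x) + 2 * (f x * f x).

Lemma smooth_rotation_form (f : R -> R) : smooth f -> smooth (rotation_form f).
Proof. intros; unfold rotation_form; smooth_tac. Qed.

Lemma RInt_nonneg_smooth (f : R -> R) (a b : R) :
  a <= b -> smooth f -> (forall x, 0 <= f x) -> 0 <= RInt f a b.
Proof. intros; apply RInt_ge_0; [easy | now apply smooth_ex_RInt | auto]. Qed.

(** The only negative term, - 3 h'^2, is absorbed by h''^2. Its hypothesis is what Wirtinger's
    inequality has to supply, in different ways for the even and the odd harmonics. *)
Lemma rotation_form_bound (h : R -> R) : smooth h ->
  3 * RInt (fun x => Derive h x * Derive h x) 0 PI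
    <= RInt (fun x => Derive (Derive h) x * Derive (Derive h) x) 0 PI ->
  2 * RInt (fun x => h x * h x) 0 PI <= RInt (rotation_form h) 0 PI.
Proof.
  intros Hh H.
  replace (RInt (rotation_form h) 0 PI) with
    (RInt (fun x => Derive (Derive h) x * Derive (Derive h) x) 0 PI
      + (-3 * RInt (fun x => Derive h x * Derive h x) 0 PI
         + 2 * RInt (fun x => h x * h x) 0 PI)); [lra|].
  rewrite <- !RInt_scal_smooth, <- !RInt_plus_smooth by smooth_tac.
  apply RInt_ext; intros; unfold rotation_form; simpl; ring.
Qed.

(* The even harmonics are pi-periodic, so Wirtinger applies to h'. *)
Lemma rotation_form_even (h : R -> R) : periodic_smooth PI h ->
  2 * RInt (fun x => h x * h x) 0 PI <= RInt (rotation_form h) 0 PI.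
Proof.
  intros Hh. assert (HP := PI_RGT_0).
  apply rotation_form_bound; [apply Hh|].
  assert (H := wirtinger_PI (Derive h) (periodic_smooth_Derive _ _ Hh)).
  rewrite <- (Rplus_0_l PI) in H at 1. rewrite RInt_Derive_periodic in H by easy.
  specialize (H eq_refl).
  assert (0 <= RInt (fun x => Derive h x * Derive h x) 0 PI).
  { apply RInt_nonneg_smooth; [lra | apply proj1 in Hh; smooth_tac | intros; nra]. }
  lra.
Qed.

(* For odd harmonics, h' cos and h' sin are pi-periodic, and the sum of the
   squares of their derivatives is h''^2 + h'^2. *)
Lemma rotation_form_odd (h : R -> R) : smooth h -> (forall x, h (x + PI) = - h x) ->
  RInt (fun x => Derive h x * cos x) 0 PI = 0 ->
  RInt (fun x => Derive h x * sin x) 0 PI = 0 ->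
  2 * RInt (fun x => h x * h x) 0 PI <= RInt (rotation_form h) 0 PI.
Proof.
  intros Hh Ha Hc Hs.
  apply rotation_form_bound; [easy|].
  destruct smooth_cos_sin as [Sc Ss].
  assert (Ha' : forall x, Derive h (x + PI) = - Derive h x).
  { intros x; rewrite <- Derive_shift by easy.
    rewrite <- Derive_opp. now apply Derive_ext. }
  assert (Pc : periodic_smooth PI (fun x => Derive h x * cos x)).
  { split; [smooth_tac|]. intros x; rewrite Ha', neg_cos; ring. }
  assert (Ps : periodic_smooth PI (fun x => Derive h x * sin x)).
  { split; [smooth_tac|]. intros x; rewrite Ha', neg_sin; ring. }
  assert (Wc := wirtinger_PI _ Pc Hc). assert (Ws := wirtinger_PI _ Ps Hs).
  rewrite Derive_smooth_mult, Derive_cos in Wc by smooth_tac.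
  rewrite Derive_smooth_mult, Derive_sin in Ws by smooth_tac.
  (* The cross terms cancel when the two Wirtinger inequalities are added: 4 int h'^2 <= int h''^2 +
     int h'^2, which leaves exactly the factor 3. *)
  assert (E1 : RInt (fun x => Derive h x * cos x * (Derive h x * cos x)) 0 PI
             + RInt (fun x => Derive h x * sin x * (Derive h x * sin x)) 0 PI
             = RInt (fun x => Derive h x * Derive h x) 0 PI).
  { rewrite <- RInt_plus_smooth by smooth_tac.
    apply RInt_ext; intros x _; generalize (sin2_cos2 x); unfold Rsqr; intros E; simpl.
    transitivity (Derive h x * Derive h x * (sin x * sin x + cos x * cos x));
      [ring | rewrite E; ring]. }
  assert (E2 : RInt (fun x => (Derive (Derive h) x * cos x + Derive h x * - sin x)
                 * (Derive (Derive h) x * cos x + Derive h x * - sin x)) 0 PI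
             + RInt (fun x => (Derive (Derive h) x * sin x + Derive h x * cos x)
                 * (Derive (Derive h) x * sin x + Derive h x * cos x)) 0 PI
             = RInt (fun x => Derive (Derive h) x * Derive (Derive h) x) 0 PI
               + RInt (fun x => Derive h x * Derive h x) 0 PI).
  { rewrite <- !RInt_plus_smooth by smooth_tac.
    apply RInt_ext; intros x _; generalize (sin2_cos2 x); unfold Rsqr; intros E; simpl.
    transitivity ((Derive (Derive h) x * Derive (Derive h) x + Derive h x * Derive h x)
        * (sin x * sin x + cos x * cos x)); [ring | rewrite E; ring]. }
  lra.
Qed.

Lemma RInt_split_half (f : R -> R) : smooth f ->
  RInt f 0 (2 * PI) = RInt (fun x => f x + f (x + PI)) 0 PI :> R.
Proof.
  intros Hf. rewrite RInt_plus_smooth, RInt_shift by (try apply smooth_shift; easy).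
  rewrite (RInt_Chasles_smooth f 0 PI) by easy.
  do 2 f_equal; ring.
Qed.

(** With [ev] and [od] twice the even and odd parts of f under the half-turn, the parallelogram
    identity turns twice a quadratic integral of f over the turn into the sum of those of [ev] and
    [od] over half a turn. *)
Lemma rotation_form_orthogonal (f : R -> R) : periodic_smooth (2 * PI) f ->
  RInt (fun x => f x * cos x) 0 (2 * PI) = 0 ->
  RInt (fun x => f x * sin x) 0 (2 * PI) = 0 ->
  2 * RInt (fun x => f x * f x) 0 (2 * PI) <= RInt (rotation_form f) 0 (2 * PI).
Proof.
  intros Pf Hc Hs. pose proof Pf as [Sf Hp].
  destruct smooth_cos_sin as [Sc Ss]. destruct periodic_smooth_cos_sin as [Pc Ps].
  assert (Sg := smooth_shift f PI Sf).
  set (g := fun x => f (x + PI)) in *.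
  assert (Dg : Derive g = fun x => Derive f (x + PI))
    by (extensionality x; now apply Derive_shift).
  assert (DDg : Derive (Derive g) = fun x => Derive (Derive f) (x + PI))
    by (rewrite Dg; extensionality x; now apply Derive_shift, smooth_Derive).
  assert (Hg : forall x, g (x + PI) = f x).
  { intros x; unfold g; rewrite <- (Hp x); f_equal; ring. }
  set (ev := fun x => f x + g x). set (od := fun x => f x - g x).
  assert (Hev : 2 * RInt (fun x => ev x * ev x) 0 PI <= RInt (rotation_form ev) 0 PI).
  { apply rotation_form_even; split; [unfold ev; smooth_tac|].
    intros x; unfold ev; rewrite Hg. unfold g; ring. }
  (* The odd case needs orthogonality for the derivative of [od]. Unfolding the half-turn into a
     full turn and integrating by parts moves the derivative onto c, so that cos and sin exchange
     roles. *)
  assert (Hd : forall c, periodic_smooth (2 * PI) c -> (forall x, c (x + PI) = - c x) ->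
      RInt (fun x => f x * Derive c x) 0 (2 * PI) = 0 ->
      RInt (fun x => Derive od x * c x) 0 PI = 0).
  { intros c Pc' Hca HI. pose proof (proj1 Pc') as Sc'.
    transitivity (RInt (fun x => Derive f x * c x) 0 (2 * PI)).
    - rewrite RInt_split_half by smooth_tac. apply RInt_ext; intros x _.
      unfold od; rewrite Derive_smooth_minus by easy. rewrite Dg, Hca; simpl; ring.
    - assert (E : RInt (Derive (fun x => f x * c x)) 0 (0 + 2 * PI) = 0 :> R)
        by (apply RInt_Derive_periodic; psmooth).
      rewrite Rplus_0_l, Derive_smooth_mult, RInt_plus_smooth in E by smooth_tac.
      simpl in *; lra. }
  assert (Hod : 2 * RInt (fun x => od x * od x) 0 PI <= RInt (rotation_form od) 0 PI).
  { apply rotation_form_odd; [unfold od; smooth_tac | | |].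
    - intros x; unfold od; rewrite Hg. unfold g; ring.
    - apply Hd; [easy | apply neg_cos|]. rewrite Derive_cos.
      transitivity (RInt (fun x => -1 * (f x * sin x)) 0 (2 * PI)).
      + apply RInt_ext; intros; simpl; ring.
      + rewrite RInt_scal_smooth, Hs by smooth_tac; simpl; ring.
    - apply Hd; [easy | apply neg_sin|]. now rewrite Derive_sin. }
  assert (Eq : 2 * RInt (rotation_form f) 0 (2 * PI)
      = RInt (rotation_form ev) 0 PI + RInt (rotation_form od) 0 PI).
  { assert (Sev : smooth ev) by (unfold ev; smooth_tac).
    assert (Sod : smooth od) by (unfold od; smooth_tac).
    rewrite RInt_split_half by now apply smooth_rotation_form.
    rewrite <- RInt_plus_smooth by now apply smooth_rotation_form.
    rewrite <- RInt_scal_smooth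
      by (apply smooth_plus; [|apply smooth_shift]; now apply smooth_rotation_form).
    apply RInt_ext; intros x _. unfold rotation_form, ev, od.
    repeat (rewrite ?Derive_smooth_plus, ?Derive_smooth_minus by smooth_tac).
    rewrite DDg, Dg. unfold g; simpl; ring. }
  assert (Ef : 2 * RInt (fun x => f x * f x) 0 (2 * PI)
      = RInt (fun x => ev x * ev x) 0 PI + RInt (fun x => od x * od x) 0 PI).
  { rewrite RInt_split_half by smooth_tac.
    rewrite <- RInt_plus_smooth by (unfold ev, od; smooth_tac).
    rewrite <- RInt_scal_smooth
      by (apply smooth_plus; [smooth_tac | apply (smooth_shift (fun x => f x * f x)); smooth_tac]).
    apply RInt_ext; intros x _. unfold ev, od, g; simpl; ring. }
  lra.
Qed.

(** The values solve the linear relations obtained by integrating (sin cos)', (sin^2)' and cos^2 +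
    sin^2 = 1 over a turn. *)
Lemma RInt_trig_squares :
  RInt (fun x => cos x * cos x) 0 (2 * PI) = PI :> R /\
  RInt (fun x => sin x * sin x) 0 (2 * PI) = PI :> R /\
  RInt (fun x => sin x * cos x) 0 (2 * PI) = 0 :> R.
Proof.
  destruct smooth_cos_sin as [Sc Ss]. destruct periodic_smooth_cos_sin as [Pc Ps].
  assert (E1 : RInt (Derive (fun x => sin x * cos x)) 0 (0 + 2 * PI) = 0 :> R)
    by (apply RInt_Derive_periodic; psmooth).
  assert (E2 : RInt (Derive (fun x => sin x * sin x)) 0 (0 + 2 * PI) = 0 :> R)
    by (apply RInt_Derive_periodic; psmooth).
  assert (E3 : RInt (fun x => cos x * cos x + sin x * sin x) 0 (2 * PI) = 2 * PI :> R).
  { transitivity (RInt (fun _ : R => 1) 0 (2 * PI)).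
    - apply RInt_ext; intros x _; generalize (sin2_cos2 x); unfold Rsqr; simpl; lra.
    - rewrite RInt_const; unfold scal; simpl; unfold mult; simpl; ring. }
  rewrite Rplus_0_l, Derive_smooth_mult, Derive_sin, Derive_cos in E1 by easy.
  rewrite Rplus_0_l, Derive_smooth_mult, Derive_sin in E2 by easy.
  rewrite RInt_plus_smooth in E2, E3 by smooth_tac.
  rewrite (RInt_ext _ (fun x => cos x * cos x + -1 * (sin x * sin x))) in E1
    by (intros; simpl; ring).
  rewrite RInt_plus_smooth, RInt_scal_smooth in E1 by smooth_tac.
  rewrite (RInt_ext (fun x => cos x * sin x) (fun x => sin x * cos x)) in E2
    by (intros; simpl; ring).
  simpl in *; lra.
Qed.

(* In Fourier modes the form is the sum of (n^2 - 1) (n^2 - 2) |f_n|^2, whose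
   weights vanish only for n = 1, -1. *)
Lemma rotation_form_positive (f : R -> R) : periodic_smooth (2 * PI) f ->
  (exists a b, forall x, f x = a * cos x + b * sin x) \/
  0 < RInt (rotation_form f) 0 (2 * PI).
Proof.
  intros Pf. pose proof (proj1 Pf) as Sf. assert (HP := PI_RGT_0).
  destruct smooth_cos_sin as [Sc Ss]. destruct periodic_smooth_cos_sin as [Pc Ps].
  destruct RInt_trig_squares as [Icc [Iss Isc]].
  (* The Fourier coefficients of the first harmonics: the remainder v is orthogonal to cos and
     sin. *)
  set (a := / PI * RInt (fun x => f x * cos x) 0 (2 * PI)).
  set (b := / PI * RInt (fun x => f x * sin x) 0 (2 * PI)).
  set (h := fun x => a * cos x + b * sin x).
  assert (Ph : periodic_smooth (2 * PI) h) by (unfold h; psmooth).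
  pose proof (proj1 Ph) as Sh.
  set (v := fun x => f x - h x).
  assert (Pv : periodic_smooth (2 * PI) v) by (unfold v; psmooth).
  pose proof (proj1 Pv) as Sv.
  assert (Hv := rotation_form_orthogonal v Pv).
  assert (Hc : RInt (fun x => v x * cos x) 0 (2 * PI) = 0).
  { transitivity (RInt (fun x => f x * cos x + (- a * (cos x * cos x) + - b * (sin x * cos x)))
      0 (2 * PI)).
    - apply RInt_ext; intros; unfold v, h; simpl; ring.
    - rewrite !RInt_plus_smooth, !RInt_scal_smooth, Icc, Isc by smooth_tac.
      unfold a; simpl; field; lra. }
  assert (Hs : RInt (fun x => v x * sin x) 0 (2 * PI) = 0).
  { transitivity (RInt (fun x => f x * sin x + (- b * (sin x * sin x) + - a * (sin x * cos x)))
      0 (2 * PI)).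
    - apply RInt_ext; intros; unfold v, h; simpl; ring.
    - rewrite !RInt_plus_smooth, !RInt_scal_smooth, Iss, Isc by smooth_tac.
      unfold b; simpl; field; lra. }
  specialize (Hv Hc Hs).
  assert (Dh2 : Derive (Derive h) = fun x => - h x).
  { unfold h; rewrite Derive_smooth_plus, !Derive_smooth_scal, Derive_sin, Derive_cos by smooth_tac.
    rewrite Derive_smooth_plus, !Derive_smooth_scal, Derive_cos by smooth_tac.
    extensionality x.
    rewrite (Derive_opp sin), Derive_sin. ring. }
  assert (Eq : RInt (rotation_form f) 0 (2 * PI) = RInt (rotation_form v) 0 (2 * PI) :> R).
  (* G is a periodic primitive of [rotation_form] f - [rotation_form] v. The cross terms and the
     terms in h alone become exact because h'' = - h. *)
  { set (G := fun x => -2 * (Derive v x * h x) - 4 * (v x * Derive h x) - 3 * (h x * Derive h x)).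
    assert (PG : periodic_smooth (2 * PI) G) by (unfold G; psmooth).
    assert (EG := RInt_Derive_periodic _ _ 0 PG). rewrite Rplus_0_l in EG.
    transitivity (RInt (rotation_form v) 0 (2 * PI) + RInt (Derive G) 0 (2 * PI));
      [|rewrite EG; simpl; ring].
    rewrite <- RInt_plus_smooth
      by (solve [now apply smooth_rotation_form | apply smooth_Derive, PG]).
    apply RInt_ext; intros x _.
    assert (Ef : f = fun x => v x + h x) by (extensionality y; unfold v; ring).
    unfold G. rewrite !Derive_smooth_minus, !Derive_smooth_scal, !Derive_smooth_mult by smooth_tac.
    unfold rotation_form. rewrite Ef.
    rewrite !Derive_smooth_plus by smooth_tac. rewrite Dh2. simpl; ring. }
  destruct (classic (exists x, v x <> 0)) as [[x0 Hx0]|Hz].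
  - right. rewrite Eq.
    (* The period starts at a point where v does not vanish, and is then shifted back to 0. *)
    assert (0 < RInt (fun x => v x * v x) x0 (x0 + 2 * PI))
      by (apply RInt_pos_of_left; [lra | smooth_tac | intros; nra | nra]).
    rewrite (RInt_periodic (2 * PI) (fun x => v x * v x)) in H by psmooth.
    simpl in *; lra.
  - left. exists a, b; intros x.
    destruct (Req_dec (v x) 0) as [E|E]; [unfold v, h in E; lra | exfalso; eauto].
Qed.

(** * Vectors and the Frenet frame *)

Definition det3 (a b c : vec3) : R :=
  px a * (py b * pz c - pz b * py c) - py a * (px b * pz c - pz b * px c)
  + pz a * (px b * py c - py b * px c).

Definition lin3 (c T E : vec3) (a b e : R) : vec3 :=
  vadd (vscal a c) (vadd (vscal b T) (vscal e E)).

Lemma vec3_ext (v w : vec3) : px v = px w -> py v = py w -> pz v = pz w -> v = w.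
Proof.
  destruct v as [[a b] c], w as [[a' b'] c']; unfold px, py, pz; simpl.
  now intros -> -> ->.
Qed.

Ltac vec_unfold :=
  unfold det3, lin3, vadd, vscal, vdot in *; unfold px, py, pz in *; simpl fst in *; simpl snd in *.

Ltac vec_ring := apply vec3_ext; vec_unfold; ring.

Definition vperiodic_smooth (P : R) (X : R -> vec3) : Prop :=
  periodic_smooth P (fun u => px (X u)) /\ periodic_smooth P (fun u => py (X u)) /\
  periodic_smooth P (fun u => pz (X u)).

Lemma vperiodic_smooth_vDerive (P : R) (X : R -> vec3) :
  vperiodic_smooth P X -> vperiodic_smooth P (vDerive X).
Proof.
  intros (H1 & H2 & H3); split; [|split];
    [exact (periodic_smooth_Derive P _ H1) | exact (periodic_smooth_Derive P _ H2)
    | exact (periodic_smooth_Derive P _ H3)].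
Qed.

Lemma vperiodic_smooth_vscal (P : R) (f : R -> R) (X : R -> vec3) :
  periodic_smooth P f -> vperiodic_smooth P X ->
  vperiodic_smooth P (fun u => vscal (f u) (X u)).
Proof.
  intros Hf (H1 & H2 & H3).
  split; [|split];
    [apply (periodic_smooth_mult P f (fun u => px (X u)))
    |apply (periodic_smooth_mult P f (fun u => py (X u)))
    |apply (periodic_smooth_mult P f (fun u => pz (X u)))]; assumption.
Qed.

Lemma vperiodic_smooth_vadd (P : R) (X Y : R -> vec3) :
  vperiodic_smooth P X -> vperiodic_smooth P Y ->
  vperiodic_smooth P (fun u => vadd (X u) (Y u)).
Proof.
  intros (H1 & H2 & H3) (K1 & K2 & K3).
  split; [|split];
    [apply (periodic_smooth_plus P (fun u => px (X u)) (fun u => px (Y u)))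
    |apply (periodic_smooth_plus P (fun u => py (X u)) (fun u => py (Y u)))
    |apply (periodic_smooth_plus P (fun u => pz (X u)) (fun u => pz (Y u)))]; assumption.
Qed.

Lemma periodic_smooth_vdot (P : R) (X Y : R -> vec3) :
  vperiodic_smooth P X -> vperiodic_smooth P Y ->
  periodic_smooth P (fun u => vdot (X u) (Y u)).
Proof.
  intros (H1 & H2 & H3) (K1 & K2 & K3). unfold vdot.
  apply periodic_smooth_plus; [apply periodic_smooth_plus|]; now apply periodic_smooth_mult.
Qed.

Lemma vDerive_vscal (P : R) (f : R -> R) (X : R -> vec3) (u : R) :
  periodic_smooth P f -> vperiodic_smooth P X ->
  vDerive (fun z => vscal (f z) (X z)) u
  = vadd (vscal (Derive f u) (X u)) (vscal (f u) (vDerive X u)).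
Proof.
  intros Hf (H1 & H2 & H3).
  apply vec3_ext; unfold vDerive, vadd, vscal, px, py, pz in *; simpl in *;
    apply Derive_mult; eapply periodic_smooth_ex_derive; eassumption.
Qed.

Lemma vDerive_vadd (P : R) (X Y : R -> vec3) (u : R) :
  vperiodic_smooth P X -> vperiodic_smooth P Y ->
  vDerive (fun z => vadd (X z) (Y z)) u = vadd (vDerive X u) (vDerive Y u).
Proof.
  intros (H1 & H2 & H3) (K1 & K2 & K3).
  apply vec3_ext; unfold vDerive, vadd, vscal, px, py, pz in *; simpl in *;
    apply Derive_plus; eapply periodic_smooth_ex_derive; eassumption.
Qed.

Definition vex_derive (X : R -> vec3) (t : R) : Prop :=
  ex_derive (fun z => px (X z)) t /\ ex_derive (fun z => py (X z)) t /\
  ex_derive (fun z => pz (X z)) t.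

Lemma vperiodic_smooth_vex_derive (P : R) (X : R -> vec3) (u : R) :
  vperiodic_smooth P X -> vex_derive X u.
Proof.
  intros (H1 & H2 & H3); split; [|split];
    eapply periodic_smooth_ex_derive; eassumption.
Qed.

Lemma is_derive_vdot (A B : R -> vec3) (t : R) :
  vex_derive A t -> vex_derive B t ->
  is_derive (fun z => vdot (A z) (B z)) t (vdot (vDerive A t) (B t) + vdot (A t) (vDerive B t)).
Proof.
  intros (A1 & A2 & A3) (B1 & B2 & B3).
  assert (G : forall a1 a2 a3 b1 b2 b3 : R -> R,
    ex_derive a1 t -> ex_derive a2 t -> ex_derive a3 t -> ex_derive b1 t -> ex_derive b2 t ->
    ex_derive b3 t ->
    is_derive (fun z => vdot (a1 z, a2 z, a3 z) (b1 z, b2 z, b3 z)) t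
    (vdot (Derive a1 t, Derive a2 t, Derive a3 t) (b1 t, b2 t, b3 t)
     + vdot (a1 t, a2 t, a3 t) (Derive b1 t, Derive b2 t, Derive b3 t))).
  { intros. unfold vdot, px, py, pz; cbn [fst snd].
    auto_derive; [repeat split; assumption|].
    repeat match goal with |- context [Derive (fun x => ?f x) t] =>
      change (Derive (fun x => f x) t) with (Derive f t) end. ring. }
  exact (G _ _ _ _ _ _ A1 A2 A3 B1 B2 B3).
Qed.

Lemma Derive_vdot (P : R) (X Y : R -> vec3) (u : R) :
  vperiodic_smooth P X -> vperiodic_smooth P Y ->
  Derive (fun z => vdot (X z) (Y z)) u = vdot (vDerive X u) (Y u) + vdot (X u) (vDerive Y u).
Proof.
  intros HX HY; apply is_derive_unique, is_derive_vdot;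
    eapply vperiodic_smooth_vex_derive; eassumption.
Qed.

Lemma vdot_sym (v w : vec3) : vdot v w = vdot w v.
Proof. unfold vdot; ring. Qed.

Lemma vdot_vadd_l (v w z : vec3) : vdot (vadd v w) z = vdot v z + vdot w z.
Proof. vec_unfold; ring. Qed.

Lemma vdot_vscal_l (a : R) (v w : vec3) : vdot (vscal a v) w = a * vdot v w.
Proof. vec_unfold; ring. Qed.

Lemma vdot_vadd_r (v w z : vec3) : vdot z (vadd v w) = vdot z v + vdot z w.
Proof. vec_unfold; ring. Qed.

Lemma vdot_vscal_r (a : R) (v w : vec3) : vdot w (vscal a v) = a * vdot w v.
Proof. vec_unfold; ring. Qed.

Ltac vdot_expand :=
  repeat rewrite ?vdot_vadd_l, ?vdot_vadd_r, ?vdot_vscal_l, ?vdot_vscal_r.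

Lemma vdot_nonneg (v : vec3) : 0 <= vdot v v.
Proof. unfold vdot; nra. Qed.

Lemma vnorm_sqr (v : vec3) : vnorm v * vnorm v = vdot v v.
Proof. apply sqrt_sqrt, vdot_nonneg. Qed.

(** The right-hand side is the Gram determinant of a, b, c, so the square of the volume depends on
    scalar products only. *)
Lemma det3_sqr (a b c : vec3) :
  det3 a b c * det3 a b c =
  vdot a a * (vdot b b * vdot c c - vdot b c * vdot b c)
  - vdot a b * (vdot a b * vdot c c - vdot b c * vdot a c)
  + vdot a c * (vdot a b * vdot b c - vdot b b * vdot a c).
Proof. vec_unfold; ring. Qed.

(** Multiplicativity of the determinant. Computations take place on coordinates, and the volume of
    the frame is a common factor that cancels in all the quotients by the initial determinant. *)
Lemma det3_lin3 (c T E : vec3) (a1 a2 a3 b1 b2 b3 c1 c2 c3 : R) :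
  det3 (lin3 c T E a1 a2 a3) (lin3 c T E b1 b2 b3) (lin3 c T E c1 c2 c3)
  = det3 (a1, a2, a3) (b1, b2, b3) (c1, c2, c3) * det3 c T E.
Proof. vec_unfold; ring. Qed.

Lemma vec3_orthogonal_zero (a b c w : vec3) : det3 a b c <> 0 ->
  vdot w a = 0 -> vdot w b = 0 -> vdot w c = 0 -> w = (0, 0, 0).
Proof.
  intros Hd Ha Hb Hc.
  assert (H : px w * det3 a b c = 0 /\ py w * det3 a b c = 0 /\ pz w * det3 a b c = 0).
  { (* Cramer's rule *)
    replace (px w * det3 a b c) with
      (vdot w a * (py b * pz c - pz b * py c) + vdot w b * (py c * pz a - pz c * py a)
       + vdot w c * (py a * pz b - pz a * py b)) by (unfold det3, vdot; ring).
    replace (py w * det3 a b c) with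
      (vdot w a * (pz b * px c - px b * pz c) + vdot w b * (pz c * px a - px c * pz a)
       + vdot w c * (pz a * px b - px a * pz b)) by (unfold det3, vdot; ring).
    replace (pz w * det3 a b c) with
      (vdot w a * (px b * py c - py b * px c) + vdot w b * (px c * py a - py c * px a)
       + vdot w c * (px a * py b - py a * px b)) by (unfold det3, vdot; ring).
    rewrite Ha, Hb, Hc; repeat split; ring. }
  destruct H as (H1 & H2 & H3).
  apply Rmult_integral in H1, H2, H3.
  apply vec3_ext; unfold px, py, pz in *; simpl; tauto.
Qed.

(* On the sphere of radius 1 / (sqrt 2 k), a curve of geodesic curvature k has
   d_s c = T, d_s T = k E - 2 k^2 c, d_s E = - k T. *)
Record frenet (k P : R) (v : R -> R) (c T E : R -> vec3) : Prop := {
  fr_k : 0 < k;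
  fr_speed_pos : forall u, 0 < v u;
  fr_speed : periodic_smooth P v;
  fr_c : vperiodic_smooth P c;
  fr_T : vperiodic_smooth P T;
  fr_E : vperiodic_smooth P E;
  fr_dc : forall u, vDerive c u = vscal (v u) (T u);
  fr_dT : forall u, vDerive T u = vscal (v u) (vadd (vscal k (E u)) (vscal (- (2 * k ^ 2)) (c u)));
  fr_dE : forall u, vDerive E u = vscal (v u) (vscal (- k) (T u));
  fr_cc : forall u, 2 * k ^ 2 * vdot (c u) (c u) = 1;
  fr_TT : forall u, vdot (T u) (T u) = 1;
  fr_EE : forall u, vdot (E u) (E u) = 1;
  fr_cT : forall u, vdot (c u) (T u) = 0;
  fr_cE : forall u, vdot (c u) (E u) = 0;
  fr_TE : forall u, vdot (T u) (E u) = 0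
}.

Lemma det3_orthogonal_neq0 (k : R) (c T E : vec3) :
  2 * k ^ 2 * vdot c c = 1 -> vdot T T = 1 -> vdot E E = 1 ->
  vdot c T = 0 -> vdot c E = 0 -> vdot T E = 0 -> det3 c T E <> 0.
Proof.
  intros Hc HT HE H1 H2 H3 H0.
  assert (D := det3_sqr c T E). rewrite H0, HT, HE, H1, H2, H3 in D. nra.
Qed.

(** The difference of the two sides is orthogonal to a basis. The weight 2 k^2 compensates for c not
    being a unit vector. *)
Lemma orthogonal_decomposition (k : R) (c T E X : vec3) :
  2 * k ^ 2 * vdot c c = 1 -> vdot T T = 1 -> vdot E E = 1 ->
  vdot c T = 0 -> vdot c E = 0 -> vdot T E = 0 ->
  X = lin3 c T E (2 * k ^ 2 * vdot X c) (vdot X T) (vdot X E).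
Proof.
  intros Hc HT HE H1 H2 H3.
  assert (Hd := det3_orthogonal_neq0 k c T E Hc HT HE H1 H2 H3).
  set (Y := lin3 c T E (2 * k ^ 2 * vdot X c) (vdot X T) (vdot X E)).
  assert (Z : vadd X (vscal (-1) Y) = (0, 0, 0)).
  { apply (vec3_orthogonal_zero c T E); [easy|..]; unfold Y, lin3; vdot_expand;
      rewrite ?(vdot_sym T c), ?(vdot_sym E c), ?(vdot_sym E T), ?H1, ?H2, ?H3, ?HT, ?HE.
    - replace (vdot X c + -1 * (2 * k ^ 2 * vdot X c * vdot c c + (vdot X T * 0 + vdot X E * 0)))
        with (vdot X c * (1 - 2 * k ^ 2 * vdot c c)) by ring. rewrite Hc; ring.
    - ring.
    - ring. }
  clearbody Y.
  destruct X as [[x1 x2] x3], Y as [[y1 y2] y3]; vec_unfold; injection Z as Z1 Z2 Z3.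
  repeat f_equal; lra.
Qed.

Lemma vdot_self_derive (P a : R) (X : R -> vec3) (u : R) : vperiodic_smooth P X ->
  (forall z, vdot (X z) (X z) = a) -> vdot (X u) (vDerive X u) = 0.
Proof.
  intros HX H. assert (D := Derive_vdot P X X u HX HX).
  rewrite (Derive_ext _ (fun _ => a)), Derive_const in D by easy.
  rewrite (vdot_sym (vDerive X u)) in D; lra.
Qed.

Lemma vdot_zero_derive (P : R) (X Y : R -> vec3) (u : R) :
  vperiodic_smooth P X -> vperiodic_smooth P Y ->
  (forall z, vdot (X z) (Y z) = 0) -> vdot (vDerive X u) (Y u) = - vdot (X u) (vDerive Y u).
Proof.
  intros HX HY H. assert (D := Derive_vdot P X Y u HX HY).
  rewrite (Derive_ext _ (fun _ => 0)), Derive_const in D by easy. lra.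
Qed.

(** * Curves on the sphere *)

Lemma closed_sphere_curve_smooth (rho P : R) (c : R -> vec3) :
  closed_sphere_curve rho P c -> vperiodic_smooth P c.
Proof.
  intros [_ Hs Hp _ _ _].
  split; [|split]; (split; [apply smooth_of_ex_derive_n; intros n u; apply (Hs n u)|]);
    intros u; now rewrite Hp.
Qed.

Lemma speed_sqr (c : R -> vec3) (u : R) :
  speed c u * speed c u = vdot (vDerive c u) (vDerive c u).
Proof. apply vnorm_sqr. Qed.

Lemma periodic_smooth_speed (rho P : R) (c : R -> vec3) :
  closed_sphere_curve rho P c -> periodic_smooth P (speed c).
Proof.
  intros H. assert (Hc := closed_sphere_curve_smooth _ _ _ H).
  assert (H1 := vperiodic_smooth_vDerive _ _ Hc).
  apply (periodic_smooth_sqrt P (fun u => vdot (vDerive c u) (vDerive c u)));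
    [|now apply periodic_smooth_vdot].
  intros u. assert (0 < speed c u) by apply H.
  rewrite <- speed_sqr; nra.
Qed.

(** Obtained by differentiating |c|^2 = rho^2 twice and the square of the speed once; these products
    feed the Gram determinant of c, c', c''. *)
Lemma sphere_curve_dots (rho P : R) (c : R -> vec3) (u : R) :
  closed_sphere_curve rho P c ->
  vdot (c u) (c u) = rho ^ 2 /\ vdot (c u) (vDerive c u) = 0 /\
  vdot (c u) (vDerive (vDerive c) u) = - speed c u ^ 2 /\
  speed c u * Derive (speed c) u = vdot (vDerive c u) (vDerive (vDerive c) u).
Proof.
  intros H. assert (Hc := closed_sphere_curve_smooth _ _ _ H).
  assert (H1 := vperiodic_smooth_vDerive _ _ Hc).
  assert (Hv := periodic_smooth_speed _ _ _ H).
  assert (Hn : forall z, vdot (c z) (c z) = rho ^ 2).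
  { intros z; rewrite <- vnorm_sqr, (csc_on_sphere _ _ _ H); ring. }
  assert (H0 : forall z, vdot (c z) (vDerive c z) = 0)
    by (intros z; exact (vdot_self_derive P _ c z Hc Hn)).
  split; [apply Hn|split; [apply H0|split]].
  - assert (E := vdot_zero_derive P c (vDerive c) u Hc H1 H0).
    rewrite <- speed_sqr in E; lra.
  - assert (E := Derive_vdot P _ _ u H1 H1).
    rewrite (Derive_ext _ (fun z => speed c z * speed c z)) in E
      by (intros; symmetry; apply speed_sqr).
    rewrite Derive_mult in E by (eapply periodic_smooth_ex_derive; eassumption).
    rewrite (vdot_sym (vDerive (vDerive c) u)) in E; lra.
Qed.

Lemma vDerive_tangent (rho P : R) (c : R -> vec3) (u : R) :
  closed_sphere_curve rho P c ->
  vDerive (tangent c) u = vadd (vscal (/ speed c u) (vDerive (vDerive c) u))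
    (vscal (- (vdot (vDerive c u) (vDerive (vDerive c) u)) / speed c u ^ 3) (vDerive c u)).
Proof.
  intros H. assert (Hv := periodic_smooth_speed _ _ _ H).
  assert (Hp := csc_regular _ _ _ H).
  destruct (sphere_curve_dots _ _ _ u H) as (_ & _ & _ & E).
  unfold tangent, d_ds.
  rewrite (vDerive_vscal P).
  - rewrite <- E, Derive_inv;
      [| eapply periodic_smooth_ex_derive; eassumption | apply Rgt_not_eq, Hp].
    specialize (Hp u). clear E.
    apply vec3_ext; vec_unfold; field; lra.
  - apply periodic_smooth_inv; [intros z; apply Rgt_not_eq, Hp | easy].
  - now apply vperiodic_smooth_vDerive, (closed_sphere_curve_smooth rho).
Qed.

Lemma vdot_d_ds_tangent (rho P : R) (c : R -> vec3) (u : R) :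
  closed_sphere_curve rho P c -> vdot (d_ds c (tangent c) u) (c u) = -1.
Proof.
  intros H. assert (Hp := csc_regular _ _ _ H u).
  destruct (sphere_curve_dots _ _ _ u H) as (_ & E1 & E2 & _).
  unfold d_ds; rewrite (vDerive_tangent rho P) by easy. vdot_expand.
  rewrite !(vdot_sym _ (c u)), E1, E2; field; lra.
Qed.

Lemma nabla_T_T_eq (rho P : R) (c : R -> vec3) (u : R) :
  0 < rho -> closed_sphere_curve rho P c ->
  nabla_T_T rho c u = vadd (d_ds c (tangent c) u) (vscal (/ rho ^ 2) (c u)).
Proof.
  intros Hr H. unfold nabla_T_T. rewrite (vdot_d_ds_tangent rho P) by easy.
  do 2 f_equal; field; lra.
Qed.

(** The signed geodesic curvature is det (c, c', c'') / (rho |c'|^3). Squares are compared because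
    the sign of the determinant depends on the orientation, while [geodesic_curvature] is a norm;
    both sides then reduce to scalar products. *)
Lemma geodesic_curvature_det3 (rho P : R) (c : R -> vec3) (u : R) :
  0 < rho -> closed_sphere_curve rho P c ->
  (rho * geodesic_curvature rho c u * speed c u ^ 3) ^ 2
  = det3 (c u) (vDerive c u) (vDerive (vDerive c) u) ^ 2.
Proof.
  intros Hr H. assert (Hp := csc_regular _ _ _ H u).
  destruct (sphere_curve_dots _ _ _ u H) as (E0 & E1 & E2 & _).
  assert (Ev := speed_sqr c u).
  replace ((rho * geodesic_curvature rho c u * speed c u ^ 3) ^ 2)
    with (rho ^ 2 * speed c u ^ 6 * (geodesic_curvature rho c u * geodesic_curvature rho c u))
    by ring.
  unfold geodesic_curvature at 1 2. rewrite vnorm_sqr.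
  rewrite (nabla_T_T_eq rho P), <- (Rsqr_pow2 (det3 _ _ _)) by easy. unfold Rsqr.
  rewrite det3_sqr. unfold d_ds. rewrite (vDerive_tangent rho P) by easy.
  vdot_expand.
  rewrite !(vdot_sym _ (c u)), (vdot_sym (vDerive (vDerive c) u) (vDerive c u)), E0, E1, E2, <- Ev.
  clear Ev E2; generalize dependent (speed c u); intros v Hv; field; lra.
Qed.

Lemma closed_sphere_curve_det3_neq0 (rho P : R) (c : R -> vec3) (u : R) :
  0 < rho -> closed_sphere_curve rho P c ->
  det3 (c u) (vDerive c u) (vDerive (vDerive c) u) <> 0.
Proof.
  intros Hr H E. assert (G := geodesic_curvature_det3 rho P c u Hr H).
  assert (Hv := csc_regular _ _ _ H u). assert (Hk := csc_curved _ _ _ H u).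
  assert (0 < rho * geodesic_curvature rho c u * speed c u ^ 3)
    by (apply Rmult_lt_0_compat; [now apply Rmult_lt_0_compat | now apply pow_lt]).
  rewrite E in G; nra.
Qed.

(** The power 2 / 6 = 1 / 3 of rho kappa_g |c'|^3 leaves the speed to the first power. The frames
    disappear from the density, which becomes a function of the first two derivatives of the
    parametrization. *)
Lemma ec_density_det3 (rho P : R) (c : R -> vec3) (u : R) :
  0 < rho -> closed_sphere_curve rho P c ->
  Rpower rho (1 / 3) * (Rpower (geodesic_curvature rho c u) (1 / 3) * speed c u)
  = Rpower (det3 (c u) (vDerive c u) (vDerive (vDerive c) u) ^ 2) (1 / 6).
Proof.
  intros Hr H. assert (Hp := csc_regular _ _ _ H u). assert (Hk := csc_curved _ _ _ H u).
  rewrite <- (geodesic_curvature_det3 rho P) by easy.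
  assert (H3 : 0 < speed c u ^ 3) by now apply pow_lt.
  assert (Hrk : 0 < rho * geodesic_curvature rho c u) by now apply Rmult_lt_0_compat.
  rewrite <- (Rpower_pow 2) by now apply Rmult_lt_0_compat.
  rewrite Rpower_mult. replace (INR 2 * (1 / 6)) with (1 / 3) by (simpl; field).
  rewrite <- Rpower_mult_distr by easy.
  rewrite <- (Rpower_mult_distr rho) by easy.
  rewrite <- (Rpower_pow 3), Rpower_mult by easy.
  replace (INR 3 * (1 / 3)) with 1 by (simpl; field).
  rewrite Rpower_1 by easy. ring.
Qed.

Lemma constant_curvature_frenet (rho P : R) (c : R -> vec3) :
  0 < rho -> closed_sphere_curve rho P c ->
  (forall u, geodesic_curvature rho c u = sqrt 2 / (2 * rho)) ->
  frenet (sqrt 2 / (2 * rho)) P (speed c) c (tangent c) (unit_normal rho c).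
Proof.
  intros Hr H Hk. set (k := sqrt 2 / (2 * rho)) in *.
  assert (Hc := closed_sphere_curve_smooth _ _ _ H).
  assert (Hc1 := vperiodic_smooth_vDerive _ _ Hc).
  assert (Hv := periodic_smooth_speed _ _ _ H).
  assert (Hp := csc_regular _ _ _ H).
  assert (Hiv : periodic_smooth P (fun u => / speed c u))
    by (apply periodic_smooth_inv; [intros z; apply Rgt_not_eq, Hp | easy]).
  assert (H2 : sqrt 2 * sqrt 2 = 2) by (apply sqrt_sqrt; lra).
  assert (Hk0 : 0 < k).
  { unfold k; apply Rdiv_lt_0_compat; [apply sqrt_lt_R0|]; lra. }
  assert (Hkr : 2 * k ^ 2 = / rho ^ 2).
  { unfold k; replace (2 * (sqrt 2 / (2 * rho)) ^ 2) with (sqrt 2 * sqrt 2 / (2 * rho ^ 2))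
      by (field; lra). rewrite H2; field; lra. }
  (* The square root is forgotten: k > 0, 2 k^2 = 1 / rho^2 and the constancy of the curvature are
     kept. *)
  clearbody k.
  assert (HT : vperiodic_smooth P (tangent c)) by now apply vperiodic_smooth_vscal.
  assert (HE : vperiodic_smooth P (unit_normal rho c)).
  { replace (unit_normal rho c) with (fun u => vscal (/ k)
      (vadd (vscal (/ speed c u) (vDerive (tangent c) u)) (vscal (/ rho ^ 2) (c u)))).
    - apply vperiodic_smooth_vscal; [apply periodic_smooth_const|].
      apply vperiodic_smooth_vadd; apply vperiodic_smooth_vscal; try easy.
      + now apply vperiodic_smooth_vDerive.
      + apply periodic_smooth_const.
    - extensionality u; unfold unit_normal.
      now rewrite Hk, (nabla_T_T_eq rho P). }
  assert (Hcc : forall u, vdot (c u) (c u) = rho ^ 2)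
    by (intros u; apply (sphere_curve_dots _ _ _ u H)).
  assert (Hc1' : forall u, vDerive c u = vscal (speed c u) (tangent c u)).
  { intros u; specialize (Hp u). unfold tangent, d_ds.
    apply vec3_ext; vec_unfold; field; lra. }
  assert (HTT : forall u, vdot (tangent c u) (tangent c u) = 1).
  { intros u; specialize (Hp u). unfold tangent, d_ds; vdot_expand.
    rewrite <- speed_sqr; field; lra. }
  assert (HcT : forall u, vdot (c u) (tangent c u) = 0).
  { intros u. destruct (sphere_curve_dots _ _ _ u H) as (_ & E & _).
    unfold tangent, d_ds; vdot_expand. rewrite E; ring. }
  assert (Hnab : forall u, nabla_T_T rho c u = vscal k (unit_normal rho c u)).
  { intros u; unfold unit_normal. rewrite Hk. generalize (nabla_T_T rho c u); intros w.
    apply vec3_ext; vec_unfold; field; lra. }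
  assert (HEE : forall u, vdot (unit_normal rho c u) (unit_normal rho c u) = 1).
  { intros u; unfold unit_normal at 1 2. vdot_expand.
    rewrite <- vnorm_sqr. fold (geodesic_curvature rho c u). rewrite Hk; field; lra. }
  assert (HcE : forall u, vdot (c u) (unit_normal rho c u) = 0).
  { intros u; unfold unit_normal. vdot_expand.
    rewrite (nabla_T_T_eq rho P) by easy. vdot_expand.
    rewrite (vdot_sym (c u) (d_ds _ _ _)), (vdot_d_ds_tangent rho P), Hcc by easy. field.
    rewrite Hk; lra. }
  assert (HTE : forall u, vdot (tangent c u) (unit_normal rho c u) = 0).
  { intros u; unfold unit_normal. vdot_expand.
    rewrite (nabla_T_T_eq rho P) by easy. unfold d_ds; vdot_expand.
    rewrite (vdot_self_derive P _ _ u HT HTT), (vdot_sym (tangent c u)), HcT; ring. }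
  assert (HdT : forall u, vDerive (tangent c) u
      = vscal (speed c u) (vadd (vscal k (unit_normal rho c u)) (vscal (- (2 * k ^ 2)) (c u)))).
  { intros u; rewrite <- Hnab, (nabla_T_T_eq rho P), Hkr by easy. specialize (Hp u).
    unfold d_ds; apply vec3_ext; vec_unfold; field; lra. }
  assert (Hcc2 : forall u, 2 * k ^ 2 * vdot (c u) (c u) = 1)
    by (intros u; rewrite Hkr, Hcc; field; lra).
  split; auto.
  intros u.
  (* The derivative of the unit normal E is found from its three coordinates, given by
     differentiating <c, E> = 0, <T, E> = 0 and <E, E> = 1. *)
  rewrite (orthogonal_decomposition k (c u) (tangent c u) (unit_normal rho c u)
    (vDerive (unit_normal rho c) u)) by auto.
  assert (E1 := vdot_zero_derive P _ _ u Hc HE HcE).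
  assert (E2 := vdot_zero_derive P _ _ u HT HE HTE).
  assert (E3 := vdot_self_derive P _ _ u HE HEE).
  rewrite Hc1' in E1. rewrite HdT in E2.
  revert E1 E2 E3. vdot_expand. rewrite HTE, HEE, HcE. intros E1 E2 E3.
  rewrite !(vdot_sym (vDerive _ _)), E3.
  replace (vdot (c u) (vDerive (unit_normal rho c) u)) with 0 by lra.
  replace (vdot (tangent c u) (vDerive (unit_normal rho c) u)) with (- (speed c u * k)) by lra.
  vec_ring.
Qed.

(** * The turning angle *)

Lemma smooth_upto_comp (n : nat) (f g : R -> R) :
  smooth f -> smooth_upto n g -> smooth_upto n (fun u => f (g u)).
Proof.
  revert f; induction n as [|n IH]; intros f Hf Hg; [easy|].
  assert (Hd : forall u, is_derive (fun u => f (g u)) u (Derive g u * Derive f (g u))).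
  { intros u. apply (is_derive_comp f g); [now apply smooth_is_derive|].
    apply Derive_correct, Hg. }
  split; [intros u; eexists; apply Hd|].
  replace (Derive (fun u => f (g u))) with (fun u => Derive g u * Derive f (g u)).
  - apply smooth_upto_mult; [apply Hg|].
    apply IH; [now apply smooth_Derive | now apply smooth_upto_S].
  - extensionality u; symmetry; apply is_derive_unique, Hd.
Qed.

Lemma smooth_of_is_derive (f g : R -> R) :
  (forall u, is_derive f u (g u)) -> smooth g -> smooth f.
Proof.
  intros Hd Hg [|n]; [easy|split; [intros u; eexists; apply Hd|]].
  replace (Derive f) with g; [apply Hg|].
  extensionality u; symmetry; apply is_derive_unique, Hd.
Qed.

Lemma smooth_increasing (f : R -> R) (a b : R) :
  smooth f -> (forall u, 0 < Derive f u) -> a < b -> f a < f b.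
Proof.
  intros Hf Hpos Hab.
  assert (H : 0 < RInt (Derive f) a b).
  { apply RInt_pos_of_left; auto; [now apply smooth_Derive|]. intros u; now apply Rlt_le. }
  rewrite RInt_Derive_smooth in H by easy; lra.
Qed.

(** A preimage is picked by choice and is unique by monotonicity, which also makes g continuous. The
    formula g' = 1 / (f' o g) then bootstraps: each order of smoothness of g gives the next. *)
Lemma smooth_inverse (f : R -> R) :
  smooth f -> (forall u, 0 < Derive f u) -> (forall x, exists u, f u = x) ->
  exists g : R -> R, smooth g /\ (forall x, f (g x) = x) /\ (forall u, g (f u) = u) /\
    forall x, is_derive g x (/ Derive f (g x)).
Proof.
  intros Hf Hpos Hsurj.
  assert (Hinc : forall a b, a < b -> f a < f b) by (intros; now apply smooth_increasing).
  assert (Hlt : forall a b, f a < f b -> a < b).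
  { intros a b H; destruct (Rtotal_order a b) as [L|[->|L]]; [easy | lra|].
    specialize (Hinc _ _ L); lra. }
  set (g := fun x => proj1_sig (constructive_indefinite_description _ (Hsurj x))).
  assert (Hfg : forall x, f (g x) = x).
  { intros x; unfold g; now destruct constructive_indefinite_description. }
  assert (Hgf : forall u, g (f u) = u).
  { intros u; destruct (Rtotal_order (g (f u)) u) as [L|[E|L]]; [|easy|];
      apply Hinc in L; rewrite Hfg in L; lra. }
  assert (Hcont : forall x, continuity_pt g x).
  { intros x eps Heps.
    assert (L1 : f (g x - eps) < x) by (rewrite <- (Hfg x) at 2; apply Hinc; lra).
    assert (L2 : x < f (g x + eps)) by (rewrite <- (Hfg x) at 1; apply Hinc; lra).
    exists (Rmin (x - f (g x - eps)) (f (g x + eps) - x)); split; [apply Rmin_glb_lt; lra|].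
    intros y [_ Hy]; simpl in *; unfold Rdist in *.
    assert (M1 := Rmin_l (x - f (g x - eps)) (f (g x + eps) - x)).
    assert (M2 := Rmin_r (x - f (g x - eps)) (f (g x + eps) - x)).
    apply Rabs_def2 in Hy.
    assert (g x - eps < g y) by (apply Hlt; rewrite Hfg; lra).
    assert (g y < g x + eps) by (apply Hlt; rewrite Hfg; lra).
    apply Rabs_def1; lra. }
  assert (Hder : forall x, is_derive g x (/ Derive f (g x))).
  { intros x. apply is_derive_Reals.
    assert (Prf : forall a, g (x - 1) <= a <= g (x + 1) -> derivable_pt f a)
      by (intros; now apply ex_derive_Reals_0, smooth_ex_derive).
    assert (Hx : g (x - 1) <= g x <= g (x + 1)).
    { split; apply Rlt_le, Hlt; rewrite !Hfg; lra. }
    pose proof (derivable_pt_lim_recip_interv f g (x - 1) (x + 1) x Prf (Hcont x)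
      ltac:(lra) ltac:(lra) Hx) as D.
    rewrite Derive_Reals in D. unfold Rdiv in D; rewrite Rmult_1_l in D.
    apply D; [intros; unfold comp, id; apply Hfg | apply Rgt_not_eq, Hpos]. }
  exists g; split; [|auto].
  intros n; induction n as [|n IH]; [easy|].
  split; [intros x; eexists; apply Hder|].
  replace (Derive g) with (fun x => / Derive f (g x)).
  - apply (smooth_upto_comp n (fun u => / Derive f u)); [|easy].
    apply smooth_inv; [intros u; apply Rgt_not_eq, Hpos | now apply smooth_Derive].
  - extensionality x; symmetry; apply is_derive_unique, Hder.
Qed.

Lemma constant_of_Derive_zero (f : R -> R) (u : R) :
  (forall z, is_derive f z 0) -> f u = f 0.
Proof.
  intros H. assert (Hs : smooth f)
    by (apply (smooth_of_is_derive f (fun _ => 0)); [easy | apply smooth_const]).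
  assert (E := RInt_Derive_smooth f 0 u Hs).
  rewrite (RInt_ext _ (fun _ => 0)) in E by (intros; apply is_derive_unique, H).
  rewrite RInt_const in E. unfold scal in E; simpl in E; unfold mult in E; simpl in E. lra.
Qed.

(** The pair (w p, n) turns at the rate of theta, so turning it back by theta gives two first
    integrals; no uniqueness theorem for differential equations is invoked. *)
Lemma harmonic_solution (theta v p n : R -> R) (w : R) : 0 < w -> theta 0 = 0 ->
  (forall u, is_derive theta u (w * v u)) ->
  (forall u, is_derive p u (v u * n u)) ->
  (forall u, is_derive n u (- w ^ 2 * (v u * p u))) ->
  forall u, n u = n 0 * cos (theta u) - w * p 0 * sin (theta u).
Proof.
  intros Hw H0 Ht Hp Hn u.
  assert (A := constant_of_Derive_zero
    (fun z => w * p z * cos (theta z) - n z * sin (theta z)) u).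
  assert (B := constant_of_Derive_zero
    (fun z => w * p z * sin (theta z) + n z * cos (theta z)) u).
  cbv beta in A, B. rewrite H0, cos_0, sin_0 in A, B.
  assert (ex : forall z, ex_derive p z /\ ex_derive n z /\ ex_derive theta z)
    by (intros z; repeat split; eexists; eauto).
  replace (n 0) with (w * p u * sin (theta u) + n u * cos (theta u)).
  - replace (w * p 0) with (w * p u * cos (theta u) - n u * sin (theta u)).
    + generalize (sin2_cos2 (theta u)); unfold Rsqr; intros E.
      transitivity (n u * (sin (theta u) * sin (theta u) + cos (theta u) * cos (theta u)));
        [rewrite E; ring | ring].
    + rewrite A; [ring|]. intros z. destruct (ex z) as (X1 & X2 & X3).
      auto_derive; [repeat split; assumption|].
      change (Derive (fun x => p x) z) with (Derive p z).
      change (Derive (fun x => n x) z) with (Derive n z).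
      change (Derive (fun x => theta x) z) with (Derive theta z).
      rewrite (is_derive_unique _ _ _ (Ht z)), (is_derive_unique _ _ _ (Hp z)),
        (is_derive_unique _ _ _ (Hn z)); ring.
  - rewrite B; [ring|]. intros z. destruct (ex z) as (X1 & X2 & X3).
    auto_derive; [repeat split; assumption|].
    change (Derive (fun x => p x) z) with (Derive p z).
    change (Derive (fun x => n x) z) with (Derive n z).
    change (Derive (fun x => theta x) z) with (Derive theta z).
    rewrite (is_derive_unique _ _ _ (Ht z)), (is_derive_unique _ _ _ (Hp z)),
      (is_derive_unique _ _ _ (Hn z)); ring.
Qed.

Lemma cos_lt_1_open_turn (x : R) : 0 < x < 2 * PI -> cos x < 1.
Proof.
  intros H. replace x with (2 * (x / 2)) by field. rewrite cos_2a_sin.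
  assert (0 < sin (x / 2)) by (apply sin_gt_0; lra). nra.
Qed.

(** Here sqrt 3 * k is the norm of dT/ds = k E - 2 k^2 c, that is, the curvature of the circle in
    space; hence the angle swept about its axis. *)
Definition turning (k : R) (v : R -> R) (u : R) : R := sqrt 3 * k * RInt v 0 u.

Lemma is_derive_turning (k : R) (v : R -> R) (u : R) :
  smooth v -> is_derive (turning k v) u (sqrt 3 * k * v u).
Proof.
  intros Hv. apply (is_derive_scal (fun u => RInt v 0 u)).
  apply (is_derive_RInt v (fun u => RInt v 0 u) 0).
  - apply filter_forall; intros z; apply (RInt_correct v), smooth_ex_RInt, Hv.
  - now apply smooth_continuous.
Qed.

Lemma smooth_turning (k : R) (v : R -> R) : smooth v -> smooth (turning k v).
Proof.
  intros Hv; apply (smooth_of_is_derive _ (fun u => sqrt 3 * k * v u));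
    [intros; now apply is_derive_turning | smooth_tac].
Qed.

Lemma turning_0 (k : R) (v : R -> R) : turning k v 0 = 0.
Proof. unfold turning; rewrite RInt_point; unfold zero; simpl; ring. Qed.

Lemma turning_shift (k P : R) (v : R -> R) (u : R) : periodic_smooth P v ->
  turning k v (u + P) = turning k v u + turning k v P.
Proof.
  intros Hv; unfold turning.
  rewrite (RInt_Chasles_smooth v 0 u), (RInt_periodic P v) by apply Hv || easy.
  ring.
Qed.

(** Periodicity makes the cosine of the total angle equal to 1, which excludes a total below one
    turn. A total above one turn would pass 2 pi at an interior parameter, where the curve would be
    back at its starting point. *)
Lemma simple_turning (k P : R) (v : R -> R) (c T E : R -> vec3) :
  0 < P -> frenet k P v c T E -> simple_curve P c -> turning k v P = 2 * PI.
Proof.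
  intros HP F Hs. pose proof F as [Hk Hv Sv Sc ST SE dc dT dE cc TT EE cT cE TE].
  assert (HPI := PI_RGT_0).
  assert (H3 : sqrt 3 * sqrt 3 = 3) by (apply sqrt_sqrt; lra).
  assert (H30 : 0 < sqrt 3) by (apply sqrt_lt_R0; lra).
  set (w := sqrt 3 * k).
  assert (Hw : 0 < w) by (unfold w; nra).
  assert (Hw2 : w ^ 2 = 3 * k ^ 2).
  { unfold w; transitivity (sqrt 3 * sqrt 3 * k ^ 2); [ring | rewrite H3; ring]. }
  set (th := turning k v).
  assert (Hth : forall u, is_derive th u (w * v u))
    by (intros; apply is_derive_turning, Sv).
  set (n := fun u => vadd (vscal k (E u)) (vscal (- (2 * k ^ 2)) (c u))).
  (* d_s^2 T = - w^2 T, so n = d_s T rotates with the angle th *)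
  assert (Hn : forall u, n u = vadd (vscal (cos (th u)) (n 0)) (vscal (- w * sin (th u)) (T 0))).
  (* The harmonic equation is scalar, so it is solved for a linear functional g, later each of the
     three coordinates. *)
  { assert (G : forall g : vec3 -> R,
      (forall a X b Y, g (vadd (vscal a X) (vscal b Y)) = a * g X + b * g Y) ->
      (forall X u, vperiodic_smooth P X -> is_derive (fun z => g (X z)) u (g (vDerive X u))) ->
      forall u, g (n u) = g (n 0) * cos (th u) - w * g (T 0) * sin (th u)).
    { intros g Hlin Hder u.
      assert (Hsc : forall a X, g (vscal a X) = a * g X).
      { intros a X. replace (vscal a X) with (vadd (vscal a X) (vscal 0 X)) by vec_ring.
        rewrite Hlin; ring. }
      apply (harmonic_solution th v (fun u => g (T u)) (fun u => g (n u)) w); auto.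
      - apply turning_0.
      - intros z. rewrite <- Hsc. unfold n; rewrite <- dT. now apply Hder.
      - intros z. evar_last; [apply Hder; unfold n; apply vperiodic_smooth_vadd;
          (apply vperiodic_smooth_vscal; [apply periodic_smooth_const | easy])|].
        unfold n. rewrite (vDerive_vadd P), !(vDerive_vscal P), dE, dc, !Derive_const;
          try (apply periodic_smooth_const); try easy;
          try (apply vperiodic_smooth_vscal; [apply periodic_smooth_const | easy]).
        rewrite Hw2.
        match goal with |- g ?X = _ => replace X with (vscal (- (3 * k ^ 2) * v z) (T z)) end;
          [rewrite Hsc; ring | vec_ring]. }
    intros u; apply vec3_ext.
    - rewrite (G px); [vec_unfold; ring | intros; vec_unfold; ring|].
      intros X z HX. apply Derive_correct. eapply periodic_smooth_ex_derive, HX.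
    - rewrite (G py); [vec_unfold; ring | intros; vec_unfold; ring|].
      intros X z HX. apply Derive_correct. eapply periodic_smooth_ex_derive, HX.
    - rewrite (G pz); [vec_unfold; ring | intros; vec_unfold; ring|].
      intros X z HX. apply Derive_correct. eapply periodic_smooth_ex_derive, HX. }
  assert (Hper : forall X : R -> vec3, vperiodic_smooth P X -> X P = X 0).
  { intros X (K1 & K2 & K3). rewrite <- (Rplus_0_l P).
    apply vec3_ext; [apply K1 | apply K2 | apply K3]. }
  assert (HnP : n P = n 0) by (unfold n; now rewrite !Hper).
  (* The scalar product of n P = n 0 with n 0 isolates the cosine, because T 0 is orthogonal to n
     0. *)
  assert (Hcos : cos (th P) = 1).
  { rewrite Hn in HnP. apply (f_equal (fun X => vdot X (n 0))) in HnP.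
    assert (D1 : vdot (T 0) (n 0) = 0).
    { unfold n; vdot_expand. rewrite TE, (vdot_sym (T 0)), cT; ring. }
    assert (D2 : vdot (n 0) (n 0) = 3 * k ^ 2).
    { unfold n; vdot_expand. rewrite EE, (vdot_sym (E 0)), cE.
      transitivity (k ^ 2 + 2 * k ^ 2 * (2 * k ^ 2 * vdot (c 0) (c 0)));
        [ring | rewrite cc; ring]. }
    revert HnP; vdot_expand. rewrite D1, D2. intros HnP.
    assert (0 < k ^ 2) by nra.
    apply (Rmult_eq_reg_r (3 * k ^ 2)); lra. }
  assert (Hpos : forall u, 0 < Derive th u).
  { intros u; rewrite (is_derive_unique _ _ _ (Hth u)). specialize (Hv u). nra. }
  assert (Sth : smooth th) by (apply smooth_turning, Sv).
  assert (Hth0 : th 0 = 0) by apply turning_0.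
  assert (HthP : 0 < th P) by (rewrite <- Hth0; now apply smooth_increasing).
  destruct (Rtotal_order (th P) (2 * PI)) as [L|[EQ|L]]; [|exact EQ|]; exfalso.
  - assert (cos (th P) < 1) by (apply cos_lt_1_open_turn; lra). lra.
  - destruct (IVT_gen th 0 P (2 * PI)) as [u [Hu Hu2]].
    + intros x; apply continuity_pt_filterlim; now apply smooth_continuous.
    + rewrite Hth0, Rmin_left, Rmax_right; lra.
    + rewrite Rmin_left, Rmax_right in Hu by lra.
      assert (u <> 0) by (intros ->; lra).
      assert (u <> P) by (intros ->; lra).
      assert (En : n u = n 0).
      { rewrite Hn, Hu2, cos_2PI, sin_2PI. vec_ring. }
      (* The vector k c + E is constant, since c' = v T and E' = - k v T; it points along the axis
         of the circle. *)
      assert (Em : forall z, vadd (vscal k (c z)) (E z) = vadd (vscal k (c 0)) (E 0)).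
      { assert (G : forall z, vDerive (fun u => vadd (vscal k (c u)) (E u)) z = (0, 0, 0)).
        { intros z. rewrite (vDerive_vadd P), (vDerive_vscal P), dc, dE, Derive_const;
            try (apply periodic_smooth_const); try easy;
            try (apply vperiodic_smooth_vscal; [apply periodic_smooth_const | easy]).
          vec_ring. }
        assert (SM : vperiodic_smooth P (fun u => vadd (vscal k (c u)) (E u))).
        { apply vperiodic_smooth_vadd; [apply vperiodic_smooth_vscal|]; try easy.
          apply periodic_smooth_const. }
        intros z; apply vec3_ext.
        - apply (constant_of_Derive_zero (fun z => px (vadd (vscal k (c z)) (E z)))); intros y.
          replace 0 with (px (vDerive (fun u => vadd (vscal k (c u)) (E u)) y)) by now rewrite G.
          apply Derive_correct; eapply periodic_smooth_ex_derive, SM.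
        - apply (constant_of_Derive_zero (fun z => py (vadd (vscal k (c z)) (E z)))); intros y.
          replace 0 with (py (vDerive (fun u => vadd (vscal k (c u)) (E u)) y)) by now rewrite G.
          apply Derive_correct; eapply periodic_smooth_ex_derive, SM.
        - apply (constant_of_Derive_zero (fun z => pz (vadd (vscal k (c z)) (E z)))); intros y.
          replace 0 with (pz (vDerive (fun u => vadd (vscal k (c u)) (E u)) y)) by now rewrite G.
          apply Derive_correct; eapply periodic_smooth_ex_derive, SM. }
      (* From k (k c + E) - n = 3 k^2 c: the position is determined by n and the constant axis
         vector. *)
      assert (Ec : forall z, c z = vscal (/ (3 * k ^ 2)) (vadd (vscal k (vadd (vscal k (c z)) (E z)))
          (vscal (-1) (n z)))).
      { intros z; unfold n; apply vec3_ext; vec_unfold; field; lra. }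
      assert (c u = c 0) by (rewrite (Ec u), (Ec 0), En, Em; easy).
      assert (u = 0) by (apply Hs; [lra | lra | easy]). lra.
Qed.

(** When v is the speed of the parametrization, this is d/ds. *)
Definition d_speed (v f : R -> R) (u : R) : R := / v u * Derive f u.

Lemma periodic_smooth_d_speed (P : R) (v f : R -> R) : (forall u, 0 < v u) ->
  periodic_smooth P v -> periodic_smooth P f -> periodic_smooth P (d_speed v f).
Proof.
  intros Hv Pv Pf. apply periodic_smooth_mult; [|now apply periodic_smooth_Derive].
  apply periodic_smooth_inv; [intros u; apply Rgt_not_eq, Hv | easy].
Qed.

(** Transport of [rotation_form_positive] along the turning angle, which is invertible and carries
    the period P to 2 pi, with d/dtheta = (1 / w) d/ds. *)
Lemma index_form_positive (k P : R) (v f : R -> R) :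
  0 < P -> 0 < k -> (forall u, 0 < v u) -> periodic_smooth P v -> turning k v P = 2 * PI ->
  periodic_smooth P f ->
  (exists a b, forall u, f u = a * cos (turning k v u) + b * sin (turning k v u)) \/
  0 < RInt (fun u => v u * (d_speed v (d_speed v f) u ^ 2 - 9 * k ^ 2 * d_speed v f u ^ 2
                     + 18 * k ^ 4 * f u ^ 2)) 0 P.
Proof.
  intros HP Hk Hv Pv HT Pf. pose proof (proj1 Pv) as Sv. assert (HPI := PI_RGT_0).
  assert (H3 : sqrt 3 * sqrt 3 = 3) by (apply sqrt_sqrt; lra).
  assert (H30 : 0 < sqrt 3) by (apply sqrt_lt_R0; lra).
  set (w := sqrt 3 * k).
  assert (Hw : 0 < w) by (unfold w; nra).
  assert (Hw2 : w ^ 2 = 3 * k ^ 2).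
  { unfold w; transitivity (sqrt 3 * sqrt 3 * k ^ 2); [ring | rewrite H3; ring]. }
  assert (Sth := smooth_turning k v Sv).
  assert (Hth : forall u, is_derive (turning k v) u (w * v u))
    by (intros; now apply is_derive_turning).
  assert (Hsh : forall u, turning k v (u + P) = turning k v u + 2 * PI)
    by (intros; rewrite (turning_shift k P) by easy; now rewrite HT).
  assert (Hth0 := turning_0 k v).
  set (th := turning k v) in *.
  assert (Dth : forall u, Derive th u = w * v u) by (intros; now apply is_derive_unique).
  assert (Hpos : forall u, 0 < Derive th u) by (intros u; rewrite Dth; specialize (Hv u); nra).
  assert (Hsurj : forall x, exists u, th u = x).
  (* Each period adds 2 pi, so the angle is unbounded in both directions and takes every value by
     continuity. *)
  { assert (Hm : forall m, th (INR m * P) = INR m * (2 * PI) /\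
      th (- (INR m * P)) = - (INR m * (2 * PI))).
    { induction m as [|m [I1 I2]].
      - simpl; rewrite !Rmult_0_l, Ropp_0; lra.
      - rewrite S_INR; split.
        + replace ((INR m + 1) * P) with (INR m * P + P) by ring. rewrite Hsh, I1; ring.
        + assert (E := Hsh (- ((INR m + 1) * P))).
          replace (- ((INR m + 1) * P) + P) with (- (INR m * P)) in E by ring.
          lra. }
    intros x. destruct (INR_unbounded (Rabs x)) as [m Hmx].
    destruct (Hm m) as [M1 M2].
    assert (Hx : Rabs x < INR m * (2 * PI)).
    { assert (1 < PI) by (assert (T := PI2_1); lra).
      assert (0 <= Rabs x) by apply Rabs_pos. nra. }
    apply Rabs_def2 in Hx.
    destruct (IVT_gen th (- (INR m * P)) (INR m * P) x) as [u [_ Hu]].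
    - intros y; apply continuity_pt_filterlim; now apply smooth_continuous.
    - rewrite M1, M2, Rmin_left, Rmax_right; lra.
    - now exists u. }
  destruct (smooth_inverse th Sth Hpos Hsurj) as (ph & Sph & Hfg & Hgf & Dph).
  assert (Hpsh : forall x, ph (x + 2 * PI) = ph x + P).
  { intros x. rewrite <- (Hgf (ph x + P)), Hsh, Hfg; easy. }
  assert (Hcomp : forall g, periodic_smooth P g -> periodic_smooth (2 * PI) (fun x => g (ph x))).
  { intros g [Sg Pg]; split; [|intros x; now rewrite Hpsh].
    intros m; apply smooth_upto_comp; [easy | apply Sph]. }
  assert (Hdc : forall g, periodic_smooth P g ->
      Derive (fun x => g (ph x)) = fun x => / w * d_speed v g (ph x)).
  { intros g [Sg _]; extensionality x. apply is_derive_unique. evar_last.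
    - apply (is_derive_comp g ph); [now apply smooth_is_derive | apply Dph].
    - rewrite Dth. unfold d_speed, scal; simpl; unfold mult; simpl. specialize (Hv (ph x)).
      field; lra. }
  assert (P1 := periodic_smooth_d_speed P v f Hv Pv Pf).
  assert (P2 := periodic_smooth_d_speed P v _ Hv Pv P1).
  set (fh := fun x => f (ph x)).
  destruct (rotation_form_positive fh (Hcomp f Pf)) as [(a & b & H)|H].
  - left; exists a, b; intros u. rewrite <- H. unfold fh; now rewrite Hgf.
  - right. pose proof (smooth_rotation_form fh (proj1 (Hcomp f Pf))) as Sr.
    pose proof (is_RInt_comp (rotation_form fh) th (fun u => w * v u) 0 P) as HC.
    rewrite Hth0, HT in HC.
    assert (HC' := HC ltac:(intros; now apply smooth_continuous)
      ltac:(intros; split; [apply Hth | apply smooth_continuous; smooth_tac])).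
    apply is_RInt_unique in HC'.
    (* With w^2 = 3 k^2 the weights 1 / w^4, - 3 / w^2, 2 are 1, - 9 k^2, 18 k^4 over 9 k^4; the
       factor w comes from dtheta = w v du. *)
    assert (E : RInt (fun y => scal (w * v y) (rotation_form fh (th y))) 0 P
      = (w / (9 * k ^ 4)) * RInt (fun u => v u * (d_speed v (d_speed v f) u ^ 2
          - 9 * k ^ 2 * d_speed v f u ^ 2 + 18 * k ^ 4 * f u ^ 2)) 0 P :> R).
    { rewrite <- RInt_scal_smooth.
      - apply RInt_ext; intros u _. unfold rotation_form, fh.
        rewrite (Hdc f Pf), Derive_smooth_scal, (Hdc _ P1), !Hgf.
        unfold scal; simpl; unfold mult; simpl.
        assert (Hw4 : / w * / w = / (3 * k ^ 2)) by (rewrite <- Hw2; field; lra).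
        transitivity (w * v u * ((/ w * / w) * (/ w * / w) * d_speed v (d_speed v f) u ^ 2
           - 3 * (/ w * / w * d_speed v f u ^ 2) + 2 * f u ^ 2)); [ring|].
        rewrite Hw4; field; lra.
      - apply (smooth_mult v); [easy|].
        refine (proj1 (_ : periodic_smooth P _)). psmooth. }
    pose proof (eq_trans (eq_sym E) HC') as HC2. rewrite <- HC2 in H.
    assert (0 < k ^ 4) by now apply pow_lt.
    assert (0 < w / (9 * k ^ 4)) by (apply Rdiv_lt_0_compat; lra).
    apply (Rmult_lt_reg_l (w / (9 * k ^ 4))); lra.
Qed.

(** * Second variation in the Frenet frame *)

Lemma Derive_d_speed (v f : R -> R) (u : R) : 0 < v u -> Derive f u = v u * d_speed v f u.
Proof. intros H; unfold d_speed; field; lra. Qed.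

Lemma d_speed_plus (v f g : R -> R) (u : R) : smooth f -> smooth g ->
  d_speed v (fun z => f z + g z) u = d_speed v f u + d_speed v g u.
Proof. intros; unfold d_speed; rewrite Derive_smooth_plus by easy; ring. Qed.

Lemma d_speed_minus (v f g : R -> R) (u : R) : smooth f -> smooth g ->
  d_speed v (fun z => f z - g z) u = d_speed v f u - d_speed v g u.
Proof. intros; unfold d_speed; rewrite Derive_smooth_minus by easy; ring. Qed.

Lemma d_speed_scal (v f : R -> R) (r u : R) :
  d_speed v (fun z => r * f z) u = r * d_speed v f u.
Proof. unfold d_speed; rewrite Derive_smooth_scal; ring. Qed.

Lemma d_speed_mult (v f g : R -> R) (u : R) : smooth f -> smooth g ->
  d_speed v (fun z => f z * g z) u = d_speed v f u * g u + f u * d_speed v g u.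
Proof. intros; unfold d_speed; rewrite Derive_smooth_mult by easy; ring. Qed.

Lemma d_speed_const (v : R -> R) (r u : R) : d_speed v (fun _ => r) u = 0.
Proof. unfold d_speed; rewrite Derive_const; ring. Qed.

Lemma vperiodic_smooth_lin3 (P : R) (c T E : R -> vec3) (a b e : R -> R) :
  vperiodic_smooth P c -> vperiodic_smooth P T -> vperiodic_smooth P E ->
  periodic_smooth P a -> periodic_smooth P b -> periodic_smooth P e ->
  vperiodic_smooth P (fun u => lin3 (c u) (T u) (E u) (a u) (b u) (e u)).
Proof.
  intros; unfold lin3; repeat apply vperiodic_smooth_vadd; now apply vperiodic_smooth_vscal.
Qed.

Lemma vDerive_lin3 (k P : R) (v : R -> R) (c T E : R -> vec3) (a b e : R -> R) (u : R) :
  frenet k P v c T E ->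
  periodic_smooth P a -> periodic_smooth P b -> periodic_smooth P e ->
  vDerive (fun u => lin3 (c u) (T u) (E u) (a u) (b u) (e u)) u =
  vscal (v u) (lin3 (c u) (T u) (E u) (d_speed v a u - 2 * k ^ 2 * b u)
    (d_speed v b u + a u - k * e u) (d_speed v e u + k * b u)).
Proof.
  intros [Hk Hv Sv Sc ST SE dc dT dE _ _ _ _ _ _] Ha Hb He.
  unfold lin3 at 1.
  rewrite (vDerive_vadd P), (vDerive_vadd P), !(vDerive_vscal P), dc, dT, dE,
    (Derive_d_speed v a), (Derive_d_speed v b), (Derive_d_speed v e);
    try easy; try (apply vperiodic_smooth_vadd); try (now apply vperiodic_smooth_vscal).
  vec_ring.
Qed.

(** The term in [Derive v] is a multiple of the first derivative. Together with the same term of c''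
    it cancels from the expansions of the determinant, which retain only the factor v^3. *)
Lemma vDerive2_lin3 (k P : R) (v : R -> R) (c T E : R -> vec3) (a b e : R -> R) (u : R) :
  frenet k P v c T E ->
  periodic_smooth P a -> periodic_smooth P b -> periodic_smooth P e ->
  let a1 := fun u => d_speed v a u - 2 * k ^ 2 * b u in
  let b1 := fun u => d_speed v b u + a u - k * e u in
  let e1 := fun u => d_speed v e u + k * b u in
  vDerive (vDerive (fun u => lin3 (c u) (T u) (E u) (a u) (b u) (e u))) u =
  vadd (vscal (Derive v u) (lin3 (c u) (T u) (E u) (a1 u) (b1 u) (e1 u)))
    (vscal (v u ^ 2) (lin3 (c u) (T u) (E u) (d_speed v a1 u - 2 * k ^ 2 * b1 u)
      (d_speed v b1 u + a1 u - k * e1 u) (d_speed v e1 u + k * b1 u))).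
Proof.
  intros F Ha Hb He a1 b1 e1. pose proof F as [Hk Hv Sv Sc ST SE _ _ _ _ _ _ _ _ _].
  assert (Da := periodic_smooth_d_speed P v a Hv Sv Ha).
  assert (Db := periodic_smooth_d_speed P v b Hv Sv Hb).
  assert (De := periodic_smooth_d_speed P v e Hv Sv He).
  assert (A1 : periodic_smooth P a1) by (unfold a1; psmooth).
  assert (B1 : periodic_smooth P b1) by (unfold b1; psmooth).
  assert (E1 : periodic_smooth P e1) by (unfold e1; psmooth).
  replace (vDerive (fun u => lin3 (c u) (T u) (E u) (a u) (b u) (e u)))
    with (fun u => vscal (v u) (lin3 (c u) (T u) (E u) (a1 u) (b1 u) (e1 u)))
    by (extensionality z; symmetry; now apply (vDerive_lin3 k P)).
  rewrite (vDerive_vscal P), (vDerive_lin3 k P v c T E a1 b1 e1) by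
    (easy || now apply vperiodic_smooth_lin3).
  unfold lin3; vec_ring.
Qed.

Lemma lin3_vscal (c T E : vec3) (r a b e : R) :
  vscal r (lin3 c T E a b e) = lin3 c T E (r * a) (r * b) (r * e).
Proof. vec_ring. Qed.

Lemma lin3_vadd (c T E : vec3) (a b e a' b' e' : R) :
  vadd (lin3 c T E a b e) (lin3 c T E a' b' e') = lin3 c T E (a + a') (b + b') (e + e').
Proof. vec_ring. Qed.

(* First and second order terms of det3 (x0 + y0) (x1 + y1) (x2 + y2) in y. *)
Definition det3_d1 (x0 x1 x2 y0 y1 y2 : vec3) : R :=
  det3 y0 x1 x2 + det3 x0 y1 x2 + det3 x0 x1 y2.

Definition det3_d2 (x0 x1 x2 y0 y1 y2 : vec3) : R :=
  2 * (det3 x0 y1 y2 + det3 y0 x1 y2 + det3 y0 y1 x2).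

Lemma frenet_lin3_c (k P : R) (v : R -> R) (c T E : R -> vec3) (u : R) :
  frenet k P v c T E ->
  c u = lin3 (c u) (T u) (E u) 1 0 0 /\
  vDerive c u = lin3 (c u) (T u) (E u) 0 (v u) 0 /\
  vDerive (vDerive c) u
  = lin3 (c u) (T u) (E u) (- (2 * k ^ 2) * v u ^ 2) (Derive v u) (k * v u ^ 2).
Proof.
  intros F. pose proof F as [Hk Hv Sv Sc ST SE dc dT dE _ _ _ _ _ _].
  split; [vec_ring|split; [rewrite dc; vec_ring|]].
  replace (vDerive c) with (fun u => vscal (v u) (T u)) by (extensionality z; now rewrite dc).
  rewrite (vDerive_vscal P), dT by easy. vec_ring.
Qed.

(** The undifferentiated e cancels: the three determinants contribute 2 k^2, - k^2 and - k^2 to its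
    coefficient. *)
Lemma det3_d1_frenet (k P : R) (v : R -> R) (c T E : R -> vec3) (a b e : R -> R) (u : R) :
  frenet k P v c T E ->
  periodic_smooth P a -> periodic_smooth P b -> periodic_smooth P e ->
  let y := fun u => lin3 (c u) (T u) (E u) (a u) (b u) (e u) in
  det3_d1 (c u) (vDerive c u) (vDerive (vDerive c) u)
    (y u) (vDerive y u) (vDerive (vDerive y) u)
  = v u ^ 3 * det3 (c u) (T u) (E u) *
    (3 * k * a u + 3 * k * d_speed v b u + d_speed v (d_speed v e) u).
Proof.
  intros F Ha Hb He y. destruct (frenet_lin3_c _ _ _ _ _ _ u F) as (E0 & E1 & E2).
  pose proof F as [Hk Hv Sv Sc ST SE dc dT dE _ _ _ _ _ _].
  assert (De := periodic_smooth_d_speed P v e Hv Sv He).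
  unfold y; rewrite (vDerive_lin3 k P v), (vDerive2_lin3 k P v) by easy.
  rewrite E1, E2. rewrite E0 at 1.
  rewrite !lin3_vscal, !lin3_vadd. unfold det3_d1. rewrite !det3_lin3.
  rewrite d_speed_plus, d_speed_scal
    by (apply De || (apply smooth_mult; [apply smooth_const | apply Hb])).
  generalize (det3 (c u) (T u) (E u)); intros Dl.
  unfold det3, px, py, pz; cbn [fst snd]. ring.
Qed.

(** Applied to the velocity, which is tangent to the sphere; hence the zero component along c. *)
Lemma det3_d2_frenet (k P : R) (v : R -> R) (c T E : R -> vec3) (W U : R -> R) (u : R) :
  frenet k P v c T E -> periodic_smooth P W -> periodic_smooth P U ->
  let y := fun u => lin3 (c u) (T u) (E u) 0 (W u) (U u) in
  let W1 := d_speed v W u in let W2 := d_speed v (d_speed v W) u in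
  let U1 := d_speed v U u in let U2 := d_speed v (d_speed v U) u in
  det3_d2 (c u) (vDerive c u) (vDerive (vDerive c) u)
    (y u) (vDerive y u) (vDerive (vDerive y) u)
  = v u ^ 3 * det3 (c u) (T u) (E u) *
    (2 * ((W1 - k * U u) * (U2 + 2 * k * W1 - k ^ 2 * U u)
          - (U1 + k * W u) * (W2 - 2 * k * U1 - 3 * k ^ 2 * W u)
          + (4 * k ^ 2 * W1 - 2 * k ^ 3 * U u) * U u
          - W u * (2 * k ^ 2 * U1)
          + 2 * k ^ 2 * U u * (W1 - k * U u))).
Proof.
  intros F HW HU y W1 W2 U1 U2. destruct (frenet_lin3_c _ _ _ _ _ _ u F) as (E0 & E1 & E2).
  pose proof F as [Hk Hv Sv Sc ST SE dc dT dE _ _ _ _ _ _].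
  assert (H0 : periodic_smooth P (fun _ => 0)) by apply periodic_smooth_const.
  assert (DW := periodic_smooth_d_speed P v W Hv Sv HW).
  assert (DU := periodic_smooth_d_speed P v U Hv Sv HU).
  unfold y; rewrite (vDerive_lin3 k P v c T E (fun _ => 0)),
    (vDerive2_lin3 k P v c T E (fun _ => 0)) by easy.
  rewrite E1, E2. rewrite E0 at 1.
  rewrite !lin3_vscal, !lin3_vadd. unfold det3_d2. rewrite !det3_lin3.
  apply proj1 in DW, DU, HW, HU.
  replace (fun u => d_speed v (fun _ => 0) u - 2 * k ^ 2 * W u) with (fun u => - (2 * k ^ 2) * W u)
    by (extensionality z; rewrite d_speed_const; ring).
  replace (fun u => d_speed v W u + 0 - k * U u) with (fun u => d_speed v W u - k * U u)
    by (extensionality z; ring).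
  rewrite d_speed_plus, d_speed_minus, !d_speed_scal, d_speed_const by smooth_tac.
  fold W1 W2 U1 U2.
  generalize (det3 (c u) (T u) (E u)); intros Dl.
  unfold det3, px, py, pz; cbn [fst snd]. ring.
Qed.

(* [f], the component of the acceleration along c, is forced by |x| = const. *)
Lemma second_variation_density (k P : R) (v : R -> R) (c T E : R -> vec3)
    (W U f b e : R -> R) :
  frenet k P v c T E -> periodic_smooth P W -> periodic_smooth P U ->
  periodic_smooth P f -> periodic_smooth P b -> periodic_smooth P e ->
  (forall u, f u = - (2 * k ^ 2) * (W u ^ 2 + U u ^ 2)) ->
  let y := fun u => lin3 (c u) (T u) (E u) 0 (W u) (U u) in
  let z := fun u => lin3 (c u) (T u) (E u) (f u) (b u) (e u) in
  let D0 := fun u => det3 (c u) (vDerive c u) (vDerive (vDerive c) u) in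
  let D1 := fun X u => det3_d1 (c u) (vDerive c u) (vDerive (vDerive c) u)
    (X u) (vDerive X u) (vDerive (vDerive X) u) in
  let D2 := fun X u => det3_d2 (c u) (vDerive c u) (vDerive (vDerive c) u)
    (X u) (vDerive X u) (vDerive (vDerive X) u) in
  exists G1 G2 : R -> R, periodic_smooth P G1 /\ periodic_smooth P G2 /\
  (forall u, D0 u <> 0) /\
  (forall u, v u * (D1 y u / (3 * D0 u)) = Derive G1 u) /\
  (forall u, v u * ((D1 z u + D2 y u) / (3 * D0 u) - 2 / 9 * (D1 y u / D0 u) ^ 2)
   = Derive G2 u - 2 / (9 * k ^ 2) *
     (v u * (d_speed v (d_speed v U) u ^ 2 - 9 * k ^ 2 * d_speed v U u ^ 2
                     + 18 * k ^ 4 * U u ^ 2))).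
Proof.
  intros F HW HU Hf Hb He Ef y z D0 D1 D2.
  pose proof F as [Hk Hv Sv Sc ST SE dc dT dE cc TT EE cT cE TE].
  assert (DW := periodic_smooth_d_speed P v W Hv Sv HW).
  assert (DU := periodic_smooth_d_speed P v U Hv Sv HU).
  assert (De := periodic_smooth_d_speed P v e Hv Sv He).
  assert (H0 : periodic_smooth P (fun _ => 0)) by apply periodic_smooth_const.
  exists (fun u => / (3 * k) * d_speed v U u + W u).
  (* Integration by parts puts b, e and every term involving W into this primitive, leaving only
     squares of U, U_s and U_ss. The factor - 2 / (9 k^2) is that of U_ss^2 in - 2 / 9 (D1 /
     D0)^2. *)
  exists (fun u => / (3 * k) * d_speed v e u + b u + (- (2 / 3)) * (W u * d_speed v W u)
    + 2 * k * (W u * U u) + (- (2 / (3 * k))) * (d_speed v W u * d_speed v U u)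
    + (- (2 / 3)) * (U u * d_speed v U u)).
  assert (Hdet : forall u, det3 (c u) (T u) (E u) <> 0)
    by (intros u; now apply (det3_orthogonal_neq0 k)).
  assert (E0 : forall u, D0 u = v u ^ 3 * det3 (c u) (T u) (E u) * k).
  { intros u; unfold D0. destruct (frenet_lin3_c _ _ _ _ _ _ u F) as (E0 & E1 & E2).
    rewrite E1, E2. rewrite E0 at 1. rewrite det3_lin3.
    generalize (det3 (c u) (T u) (E u)); intros Dl.
    unfold det3, px, py, pz; cbn [fst snd]. ring. }
  split; [psmooth|]. split; [psmooth|]. split; [|split].
  - intros u; rewrite E0. specialize (Hdet u). specialize (Hv u).
    repeat apply Rmult_integral_contrapositive_currified; try apply pow_nonzero; lra || easy.
  - intros u. unfold D1, y. rewrite (det3_d1_frenet k P v c T E (fun _ => 0) W U) by easy.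
    rewrite E0, (Derive_d_speed v) by easy.
    apply proj1 in DW, DU, HW, HU.
    rewrite d_speed_plus, d_speed_scal by smooth_tac.
    specialize (Hdet u); specialize (Hv u). field. repeat split; lra || easy.
  - intros u. unfold D1, D2, y, z.
    rewrite (det3_d1_frenet k P v c T E (fun _ => 0) W U), (det3_d1_frenet k P v c T E f b e),
      (det3_d2_frenet k P v c T E W U) by easy.
    rewrite E0, (Derive_d_speed v) by easy. rewrite Ef.
    apply proj1 in DW, DU, HW, HU, De, Hb, He.
    rewrite !d_speed_plus, !d_speed_scal, !d_speed_mult by smooth_tac.
    specialize (Hdet u); specialize (Hv u). field. repeat split; lra || easy.
Qed.

(** * Differentiation in families of curves *)

Definition strip_smooth (t0 delta : R) (f : R -> R -> R) : Prop :=
  forall n t u, Rabs (t - t0) < delta -> ex_diff_n f n t u.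

Definition vDt (x : R -> R -> vec3) (t u : R) : vec3 := vDerive (fun t' => x t' u) t.
Definition vDu (x : R -> R -> vec3) (t u : R) : vec3 := vDerive (x t) u.

Lemma locally_strip (t0 delta t : R) : Rabs (t - t0) < delta ->
  locally t (fun t' => Rabs (t' - t0) < delta).
Proof.
  intros H. exists (mkposreal (delta - Rabs (t - t0)) ltac:(lra)). intros y Hy.
  change (Rabs (y - t) < delta - Rabs (t - t0)) in Hy.
  replace (y - t0) with ((y - t) + (t - t0)) by ring.
  eapply Rle_lt_trans; [apply Rabs_triang | lra].
Qed.

Lemma locally_2d_strip (t0 delta t u : R) (Q : R -> R -> Prop) : Rabs (t - t0) < delta ->
  (forall t' u', Rabs (t' - t0) < delta -> Q t' u') -> locally_2d Q t u.
Proof.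
  intros H HQ. exists (mkposreal (delta - Rabs (t - t0)) ltac:(lra)). intros t' u' Ht _.
  simpl in Ht. apply HQ. replace (t' - t0) with ((t' - t) + (t - t0)) by ring.
  eapply Rle_lt_trans; [apply Rabs_triang | lra].
Qed.

Lemma strip_smooth_Dt (t0 delta : R) (f : R -> R -> R) : strip_smooth t0 delta f ->
  strip_smooth t0 delta (fun t u => Derive (fun z => f z u) t).
Proof. intros H n t u Ht; apply (H (S n) t u Ht). Qed.

Lemma strip_smooth_Du (t0 delta : R) (f : R -> R -> R) : strip_smooth t0 delta f ->
  strip_smooth t0 delta (fun t u => Derive (fun z => f t z) u).
Proof. intros H n t u Ht; apply (H (S n) t u Ht). Qed.

Lemma strip_smooth_Schwarz (t0 delta : R) (f : R -> R -> R) (t u : R) :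
  strip_smooth t0 delta f -> Rabs (t - t0) < delta ->
  Derive (fun t' => Derive (fun u' => f t' u') u) t
  = Derive (fun u' => Derive (fun t' => f t' u') t) u.
Proof.
  intros H Ht. assert (H1 := strip_smooth_Dt _ _ _ H). assert (H2 := strip_smooth_Du _ _ _ H).
  apply Schwarz.
  - apply (locally_2d_strip t0 delta); [easy|]. intros t' u' Ht'.
    split; [apply (H 1%nat t' u' Ht')|split; [apply (H 1%nat t' u' Ht')|split]].
    + apply (H2 1%nat t' u' Ht').
    + apply (H1 1%nat t' u' Ht').
  - apply (strip_smooth_Dt _ _ _ H2 0%nat t u Ht).
  - apply (strip_smooth_Du _ _ _ H1 0%nat t u Ht).
Qed.

Lemma strip_smooth_slice (t0 delta : R) (f : R -> R -> R) (t : R) :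
  strip_smooth t0 delta f -> Rabs (t - t0) < delta -> smooth (f t).
Proof.
  intros H Ht n; revert f H; induction n as [|n IH]; intros f H; [easy|].
  split; [intros u; apply (H 1%nat t u Ht)|].
  apply (IH _ (strip_smooth_Du _ _ _ H)).
Qed.

Lemma smooth_family_components (t0 delta : R) (x : R -> R -> vec3) :
  smooth_family t0 delta x <->
  strip_smooth t0 delta (fun t u => px (x t u)) /\
  strip_smooth t0 delta (fun t u => py (x t u)) /\
  strip_smooth t0 delta (fun t u => pz (x t u)).
Proof.
  split.
  - intros H; split; [|split]; intros n t u Ht; apply (H n t u Ht).
  - intros (H1 & H2 & H3) n t u Ht; auto.
Qed.

Lemma smooth_family_vDt (t0 delta : R) (x : R -> R -> vec3) :
  smooth_family t0 delta x -> smooth_family t0 delta (vDt x).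
Proof.
  rewrite !smooth_family_components. intros (H1 & H2 & H3).
  split; [|split];
    [exact (strip_smooth_Dt _ _ _ H1) | exact (strip_smooth_Dt _ _ _ H2)
    | exact (strip_smooth_Dt _ _ _ H3)].
Qed.

Lemma smooth_family_vDu (t0 delta : R) (x : R -> R -> vec3) :
  smooth_family t0 delta x -> smooth_family t0 delta (vDu x).
Proof.
  rewrite !smooth_family_components. intros (H1 & H2 & H3).
  split; [|split];
    [exact (strip_smooth_Du _ _ _ H1) | exact (strip_smooth_Du _ _ _ H2)
    | exact (strip_smooth_Du _ _ _ H3)].
Qed.

(** The velocity is expanded in the Frenet frame only at the initial time, as a function of u. This
    exchange and the following ones express all mixed derivatives by u-derivatives of the velocity
    and the acceleration. *)
Lemma vDt_vDu (t0 delta : R) (x : R -> R -> vec3) (t u : R) :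
  smooth_family t0 delta x -> Rabs (t - t0) < delta -> vDt (vDu x) t u = vDu (vDt x) t u.
Proof.
  rewrite smooth_family_components. intros (H1 & H2 & H3) Ht.
  apply vec3_ext;
    [exact (strip_smooth_Schwarz _ _ _ t u H1 Ht) | exact (strip_smooth_Schwarz _ _ _ t u H2 Ht)
    | exact (strip_smooth_Schwarz _ _ _ t u H3 Ht)].
Qed.

Lemma vDerive_ext_loc (X Y : R -> vec3) (u : R) :
  locally u (fun z => X z = Y z) -> vDerive X u = vDerive Y u.
Proof.
  intros H; apply vec3_ext; apply Derive_ext_loc; apply (filter_imp _ _ (fun z E => f_equal _ E) H).
Qed.

Lemma vDt_vDu_vDu (t0 delta : R) (x : R -> R -> vec3) (t u : R) :
  smooth_family t0 delta x -> Rabs (t - t0) < delta ->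
  vDt (vDu (vDu x)) t u = vDu (vDu (vDt x)) t u.
Proof.
  intros H Ht. rewrite (vDt_vDu t0 delta) by (now apply smooth_family_vDu || easy).
  unfold vDu at 1 3; f_equal. extensionality z. now apply (vDt_vDu t0 delta).
Qed.

Lemma vDt_vDt_vDu (t0 delta : R) (x : R -> R -> vec3) (t u : R) :
  smooth_family t0 delta x -> Rabs (t - t0) < delta ->
  vDt (vDt (vDu x)) t u = vDu (vDt (vDt x)) t u.
Proof.
  intros H Ht. rewrite <- (vDt_vDu t0 delta) by (now apply smooth_family_vDt || easy).
  apply vDerive_ext_loc. apply (filter_imp (fun t' => Rabs (t' - t0) < delta));
    [|now apply locally_strip].
  intros t' Ht'; now apply (vDt_vDu t0 delta).
Qed.

Lemma vDt_vDt_vDu_vDu (t0 delta : R) (x : R -> R -> vec3) (t u : R) :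
  smooth_family t0 delta x -> Rabs (t - t0) < delta ->
  vDt (vDt (vDu (vDu x))) t u = vDu (vDu (vDt (vDt x))) t u.
Proof.
  intros H Ht. rewrite <- (vDt_vDu_vDu t0 delta) by (now apply smooth_family_vDt || easy).
  apply vDerive_ext_loc. apply (filter_imp (fun t' => Rabs (t' - t0) < delta));
    [|now apply locally_strip].
  intros t' Ht'; now apply (vDt_vDu_vDu t0 delta).
Qed.

Lemma smooth_family_vex_derive (t0 delta : R) (x : R -> R -> vec3) (t u : R) :
  smooth_family t0 delta x -> Rabs (t - t0) < delta -> vex_derive (fun t' => x t' u) t.
Proof.
  rewrite smooth_family_components. intros (H1 & H2 & H3) Ht.
  split; [|split]; [apply (H1 1%nat t u Ht) | apply (H2 1%nat t u Ht) | apply (H3 1%nat t u Ht)].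
Qed.

Lemma is_derive_det3 (A B C : R -> vec3) (t : R) :
  vex_derive A t -> vex_derive B t -> vex_derive C t ->
  is_derive (fun z => det3 (A z) (B z) (C z)) t
    (det3_d1 (A t) (B t) (C t) (vDerive A t) (vDerive B t) (vDerive C t)).
Proof.
  intros (A1 & A2 & A3) (B1 & B2 & B3) (C1 & C2 & C3).
  assert (G : forall a1 a2 a3 b1 b2 b3 c1 c2 c3 : R -> R,
    ex_derive a1 t -> ex_derive a2 t -> ex_derive a3 t -> ex_derive b1 t -> ex_derive b2 t ->
    ex_derive b3 t -> ex_derive c1 t -> ex_derive c2 t -> ex_derive c3 t ->
    is_derive (fun z => det3 (a1 z, a2 z, a3 z) (b1 z, b2 z, b3 z) (c1 z, c2 z, c3 z)) t
    (det3_d1 (a1 t, a2 t, a3 t) (b1 t, b2 t, b3 t) (c1 t, c2 t, c3 t)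
      (Derive a1 t, Derive a2 t, Derive a3 t) (Derive b1 t, Derive b2 t, Derive b3 t)
      (Derive c1 t, Derive c2 t, Derive c3 t))).
  { intros. unfold det3_d1, det3, px, py, pz; cbn [fst snd].
    auto_derive; [repeat split; assumption|].
    repeat match goal with |- context [Derive (fun x => ?f x) t] =>
      change (Derive (fun x => f x) t) with (Derive f t) end. ring. }
  exact (G _ _ _ _ _ _ _ _ _ A1 A2 A3 B1 B2 B3 C1 C2 C3).
Qed.

Lemma continuity_2d_det3 (A B C : R -> R -> vec3) (t0 delta t u : R) :
  smooth_family t0 delta A -> smooth_family t0 delta B -> smooth_family t0 delta C ->
  Rabs (t - t0) < delta -> continuity_2d_pt (fun t u => det3 (A t u) (B t u) (C t u)) t u.
Proof.
  intros HA HB HC Ht.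
  destruct (HA 0%nat t u Ht) as ([A1 _] & [A2 _] & [A3 _]).
  destruct (HB 0%nat t u Ht) as ([B1 _] & [B2 _] & [B3 _]).
  destruct (HC 0%nat t u Ht) as ([C1 _] & [C2 _] & [C3 _]).
  unfold det3.
  repeat first [assumption | apply continuity_2d_pt_minus | apply continuity_2d_pt_plus
    | apply continuity_2d_pt_opp
    | apply continuity_2d_pt_mult].
Qed.

Lemma continuity_2d_pt_continuous_r (f : R -> R -> R) (t u : R) :
  continuity_2d_pt f t u -> continuous (f t) u.
Proof.
  intros H. apply continuity_pt_filterlim. intros eps Heps.
  destruct (H (mkposreal eps Heps)) as [d Hd]. exists d; split; [apply cond_pos|].
  intros y [_ Hy]. apply (Hd t y); [|exact Hy].
  rewrite Rminus_diag, Rabs_R0; apply cond_pos.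
Qed.

(** Joint continuity makes every slice integrable and justifies differentiation under the integral
    sign at every time of the strip, which permits a second differentiation. *)
Lemma is_derive_RInt_strip (f df : R -> R -> R) (t0 delta a b t : R) :
  (forall t u, Rabs (t - t0) < delta -> is_derive (fun z => f z u) t (df t u)) ->
  (forall t u, Rabs (t - t0) < delta -> continuity_2d_pt f t u) ->
  (forall t u, Rabs (t - t0) < delta -> continuity_2d_pt df t u) ->
  Rabs (t - t0) < delta ->
  is_derive (fun t => RInt (f t) a b) t (RInt (df t) a b).
Proof.
  intros Hd Hf Hdf Ht.
  evar_last.
  - apply (is_derive_RInt_param f a b t).
    + apply (filter_imp (fun t' => Rabs (t' - t0) < delta)); [|now apply locally_strip].
      intros t' Ht' u _. eexists; now apply Hd.
    + intros u _. apply (continuity_2d_pt_ext_loc df); [|now apply Hdf].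
      apply (locally_2d_strip t0 delta); [easy|]. intros t' u' Ht'.
      symmetry; now apply is_derive_unique, Hd.
    + apply (filter_imp (fun t' => Rabs (t' - t0) < delta)); [|now apply locally_strip].
      intros t' Ht'. apply (ex_RInt_continuous (f t')); intros u _.
      now apply continuity_2d_pt_continuous_r, Hf.
  - apply RInt_ext; intros u _. now apply is_derive_unique, Hd.
Qed.

(** For nonzero w this is |w|^(1/3); squaring gives [Rpower] a positive base whatever the sign of
    the determinant. *)
Definition sixth_root_sqr (w : R) : R := Rpower (w ^ 2) (1 / 6).

Lemma is_derive_sixth_root_sqr (w : R) : w <> 0 ->
  is_derive sixth_root_sqr w (sixth_root_sqr w / (3 * w)).
Proof.
  intros Hw. assert (Hp : 0 < w ^ 2) by nra.
  unfold sixth_root_sqr, Rpower. auto_derive; [nra|].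
  change (w * (w * 1)) with (w ^ 2). generalize (exp (1 / 6 * ln (w ^ 2))); intros r.
  field; lra.
Qed.

Lemma is_derive_sixth_root_sqr_comp (D : R -> R) (d t : R) : D t <> 0 -> is_derive D t d ->
  is_derive (fun z => sixth_root_sqr (D z)) t (sixth_root_sqr (D t) * (d / (3 * D t))).
Proof.
  intros HD Hd. evar_last.
  - apply (is_derive_comp sixth_root_sqr D); [now apply is_derive_sixth_root_sqr | exact Hd].
  - unfold scal; simpl; unfold mult; simpl. field; lra.
Qed.

(* With F w = (w^2)^(1/6) one has F' w = F w / (3 w), for either sign of w. *)
Lemma sixth_root_integral_derivatives (D D1 D2 : R -> R -> R) (t0 delta P : R) :
  0 < delta ->
  (forall t u, Rabs (t - t0) < delta -> D t u <> 0) ->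
  (forall t u, Rabs (t - t0) < delta -> is_derive (fun z => D z u) t (D1 t u)) ->
  (forall t u, Rabs (t - t0) < delta -> is_derive (fun z => D1 z u) t (D2 t u)) ->
  (forall t u, Rabs (t - t0) < delta -> continuity_2d_pt D t u) ->
  (forall t u, Rabs (t - t0) < delta -> continuity_2d_pt D1 t u) ->
  (forall t u, Rabs (t - t0) < delta -> continuity_2d_pt D2 t u) ->
  let L1 := fun t => RInt (fun u => sixth_root_sqr (D t u) * (D1 t u / (3 * D t u))) 0 P in
  (forall t, Rabs (t - t0) < delta ->
    is_derive (fun t => RInt (fun u => sixth_root_sqr (D t u)) 0 P) t (L1 t)) /\
  is_derive L1 t0 (RInt (fun u => sixth_root_sqr (D t0 u) *
    (D2 t0 u / (3 * D t0 u) - 2 / 9 * (D1 t0 u / D t0 u) ^ 2)) 0 P).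
Proof.
  intros Hdelta Hnz HD HD1 CD CD1 CD2 L1.
  assert (CF : forall t u, Rabs (t - t0) < delta ->
      continuity_2d_pt (fun t u => sixth_root_sqr (D t u)) t u).
  { intros t u Ht. apply (continuity_1d_2d_pt_comp sixth_root_sqr); [|now apply CD].
    apply continuity_pt_filterlim, (ex_derive_continuous sixth_root_sqr).
    eexists; now apply is_derive_sixth_root_sqr, Hnz. }
  assert (CI : forall t u, Rabs (t - t0) < delta -> continuity_2d_pt (fun t u => / D t u) t u).
  { intros t u Ht; apply continuity_2d_pt_inv; [now apply CD | now apply Hnz]. }
  assert (CG : forall t u, Rabs (t - t0) < delta ->
      continuity_2d_pt (fun t u => sixth_root_sqr (D t u) * (D1 t u / (3 * D t u))) t u).
  { intros t u Ht.
    apply (continuity_2d_pt_ext (fun t u => sixth_root_sqr (D t u) * (D1 t u * (/ 3 * / D t u)))).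
    - intros; unfold Rdiv; now rewrite Rinv_mult.
    - repeat apply continuity_2d_pt_mult; auto. apply continuity_2d_pt_const. }
  split.
  - intros t Ht.
    apply (is_derive_RInt_strip (fun t u => sixth_root_sqr (D t u))
      (fun t u => sixth_root_sqr (D t u) * (D1 t u / (3 * D t u))) t0 delta); auto.
    intros t' u Ht'. apply (is_derive_sixth_root_sqr_comp (fun z => D z u)); auto.
  - assert (Ht0 : Rabs (t0 - t0) < delta) by (rewrite Rminus_diag, Rabs_R0; easy).
    apply (is_derive_RInt_strip (fun t u => sixth_root_sqr (D t u) * (D1 t u / (3 * D t u)))
      (fun t u => sixth_root_sqr (D t u) *
        (D2 t u / (3 * D t u) - 2 / 9 * (D1 t u / D t u) ^ 2)) t0 delta); auto.
    + intros t u Ht. assert (Hn := Hnz t u Ht).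
      (* The coefficient of (D1 / D)^2 is 1 / 9 from the root and - 1 / 3 from this quotient, in
         total - 2 / 9. *)
      assert (HQ : is_derive (fun z => D1 z u / (3 * D z u)) t
        ((D2 t u * (3 * D t u) - D1 t u * (3 * D1 t u)) / (3 * D t u) ^ 2)).
      { apply (is_derive_div (fun z => D1 z u) (fun z => 3 * D z u)); [now apply HD1 | | lra].
        apply (is_derive_scal (fun z => D z u)). now apply HD. }
      evar_last.
      * apply (is_derive_mult (fun z => sixth_root_sqr (D z u)) (fun z => D1 z u / (3 * D z u)));
          [apply (is_derive_sixth_root_sqr_comp (fun z => D z u)); [easy | now apply HD]
          | exact HQ | intros; apply Rmult_comm].
      * unfold plus, mult; simpl. field; easy.
    + intros t u Ht.
      apply (continuity_2d_pt_ext (fun t u => sixth_root_sqr (D t u) *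
        (D2 t u * (/ 3 * / D t u) - 2 / 9 * ((D1 t u * / D t u) * (D1 t u * / D t u))))).
      * intros; unfold Rdiv; rewrite Rinv_mult. ring.
      * repeat first [apply continuity_2d_pt_const | apply continuity_2d_pt_mult
          | apply continuity_2d_pt_minus | now auto].
Qed.

(** * Variations of the equi-centro-affine length *)

Definition family_det (x : R -> R -> vec3) (t u : R) : R :=
  det3 (x t u) (vDu x t u) (vDu (vDu x) t u).

Definition family_det_t (x : R -> R -> vec3) (t u : R) : R :=
  det3_d1 (x t u) (vDu x t u) (vDu (vDu x) t u)
    (vDt x t u) (vDt (vDu x) t u) (vDt (vDu (vDu x)) t u).

Definition family_det_tt (x : R -> R -> vec3) (t u : R) : R :=
  det3_d1 (x t u) (vDu x t u) (vDu (vDu x) t u)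
    (vDt (vDt x) t u) (vDt (vDt (vDu x)) t u) (vDt (vDt (vDu (vDu x))) t u)
  + det3_d2 (x t u) (vDu x t u) (vDu (vDu x) t u)
    (vDt x t u) (vDt (vDu x) t u) (vDt (vDu (vDu x)) t u).

Lemma is_derive_family_det (x : R -> R -> vec3) (t0 delta t u : R) :
  smooth_family t0 delta x -> Rabs (t - t0) < delta ->
  is_derive (fun z => family_det x z u) t (family_det_t x t u) /\
  is_derive (fun z => family_det_t x z u) t (family_det_tt x t u).
Proof.
  intros H Ht.
  assert (Hu := smooth_family_vDu _ _ _ H). assert (Huu := smooth_family_vDu _ _ _ Hu).
  assert (ex : forall y, smooth_family t0 delta y -> vex_derive (fun z => y z u) t)
    by (intros; now apply (smooth_family_vex_derive t0 delta)).
  assert (Et := ex _ (smooth_family_vDt _ _ _ H)).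
  assert (Eut := ex _ (smooth_family_vDt _ _ _ Hu)).
  assert (Euut := ex _ (smooth_family_vDt _ _ _ Huu)).
  split.
  - apply (is_derive_det3 (fun z => x z u) (fun z => vDu x z u)
          (fun z => vDu (vDu x) z u)); auto.
  - unfold family_det_t, det3_d1 at 1. evar_last.
    + apply (is_derive_plus (V := R_NormedModule)
        (fun z => det3 (vDt x z u) (vDu x z u) (vDu (vDu x) z u)
                  + det3 (x z u) (vDt (vDu x) z u) (vDu (vDu x) z u))
        (fun z => det3 (x z u) (vDu x z u) (vDt (vDu (vDu x)) z u)));
      [apply (is_derive_plus (V := R_NormedModule)
        (fun z => det3 (vDt x z u) (vDu x z u) (vDu (vDu x) z u))
        (fun z => det3 (x z u) (vDt (vDu x) z u) (vDu (vDu x) z u)))|].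
      * apply (is_derive_det3 (fun z => vDt x z u) (fun z => vDu x z u)
          (fun z => vDu (vDu x) z u)); auto.
      * apply (is_derive_det3 (fun z => x z u) (fun z => vDt (vDu x) z u)
          (fun z => vDu (vDu x) z u)); auto.
      * apply (is_derive_det3 (fun z => x z u) (fun z => vDu x z u)
          (fun z => vDt (vDu (vDu x)) z u)); auto.
    + unfold family_det_tt, det3_d1, det3_d2, plus; simpl.
      fold (vDt x t u) (vDt (vDu x) t u) (vDt (vDu (vDu x)) t u).
      fold (vDt (vDt x) t u) (vDt (vDt (vDu x)) t u) (vDt (vDt (vDu (vDu x))) t u).
      ring.
Qed.

Lemma continuity_2d_family_det (x : R -> R -> vec3) (t0 delta t u : R) :
  smooth_family t0 delta x -> Rabs (t - t0) < delta ->
  continuity_2d_pt (family_det x) t u /\ continuity_2d_pt (family_det_t x) t u /\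
  continuity_2d_pt (family_det_tt x) t u.
Proof.
  intros H Ht.
  assert (Hu := smooth_family_vDu _ _ _ H). assert (Huu := smooth_family_vDu _ _ _ Hu).
  assert (Ht1 := smooth_family_vDt _ _ _ H). assert (Hut := smooth_family_vDt _ _ _ Hu).
  assert (Huut := smooth_family_vDt _ _ _ Huu).
  assert (Htt := smooth_family_vDt _ _ _ Ht1). assert (Hutt := smooth_family_vDt _ _ _ Hut).
  assert (Huutt := smooth_family_vDt _ _ _ Huut).
  unfold family_det, family_det_t, family_det_tt, det3_d1, det3_d2.
  split; [now apply (continuity_2d_det3 _ _ _ t0 delta)|].
  split; repeat first [now apply (continuity_2d_det3 _ _ _ t0 delta)
    | apply continuity_2d_pt_plus | apply continuity_2d_pt_mult | apply continuity_2d_pt_const].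
Qed.

(** Differentiating |x|^2 = rho^2 twice in time fixes the radial part of the acceleration. *)
Lemma family_velocity_dots (rho : R) (x : R -> R -> vec3) (t0 delta u : R) :
  0 < delta -> smooth_family t0 delta x ->
  (forall t, Rabs (t - t0) < delta -> vdot (x t u) (x t u) = rho ^ 2) ->
  vdot (vDt (vDt x) t0 u) (x t0 u) = - vdot (vDt x t0 u) (vDt x t0 u).
Proof.
  intros Hd H Hs. assert (Ht := smooth_family_vDt _ _ _ H).
  assert (Ht0 : Rabs (t0 - t0) < delta) by (rewrite Rminus_diag, Rabs_R0; easy).
  assert (E : forall t, Rabs (t - t0) < delta -> vdot (vDt x t u) (x t u) = 0).
  { intros t Htd.
    assert (X := smooth_family_vex_derive _ _ _ t u H Htd).
    assert (D := is_derive_unique _ _ _ (is_derive_vdot _ _ _ X X)).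
    rewrite (Derive_ext_loc _ (fun _ => rho ^ 2)), Derive_const in D.
    - fold (vDt x t u) in D. rewrite (vdot_sym (x t u)) in D. lra.
    - apply (filter_imp (fun t' => Rabs (t' - t0) < delta)); [auto | now apply locally_strip]. }
  assert (D := is_derive_unique _ _ _ (is_derive_vdot _ _ _
    (smooth_family_vex_derive _ _ _ t0 u Ht Ht0) (smooth_family_vex_derive _ _ _ t0 u H Ht0))).
  rewrite (Derive_ext_loc _ (fun _ => 0)), Derive_const in D.
  - fold (vDt x t0 u) (vDt (vDt x) t0 u) in D. lra.
  - apply (filter_imp (fun t' => Rabs (t' - t0) < delta)); [auto | now apply locally_strip].
Qed.

Lemma vperiodic_smooth_slice (P t0 delta : R) (x : R -> R -> vec3) (t : R) :
  smooth_family t0 delta x -> Rabs (t - t0) < delta -> (forall u, x t (u + P) = x t u) ->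
  vperiodic_smooth P (x t).
Proof.
  rewrite smooth_family_components. intros (H1 & H2 & H3) Ht Hp.
  split; [|split]; (split; [|intros u; now rewrite Hp]).
  - exact (strip_smooth_slice _ _ _ t H1 Ht).
  - exact (strip_smooth_slice _ _ _ t H2 Ht).
  - exact (strip_smooth_slice _ _ _ t H3 Ht).
Qed.

Lemma vDt_periodic (P t0 delta : R) (x : R -> R -> vec3) (t u : R) :
  (forall t u, Rabs (t - t0) < delta -> x t (u + P) = x t u) -> Rabs (t - t0) < delta ->
  vDt x t (u + P) = vDt x t u.
Proof.
  intros Hp Ht. apply vDerive_ext_loc.
  apply (filter_imp (fun t' => Rabs (t' - t0) < delta)); [auto | now apply locally_strip].
Qed.

Lemma ec_length_family_det (rho P t0 delta : R) (x : R -> R -> vec3) (t : R) :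
  0 < rho -> smooth_family t0 delta x -> Rabs (t - t0) < delta ->
  closed_sphere_curve rho P (x t) ->
  ec_length rho P (x t) = RInt (fun u => sixth_root_sqr (family_det x t u)) 0 P :> R.
Proof.
  intros Hr H Ht Hc. unfold ec_length.
  assert (Hp : 0 < Rpower rho (1 / 3)) by apply exp_pos.
  assert (Hn : forall u, family_det x t u <> 0)
    by (intros u; exact (closed_sphere_curve_det3_neq0 rho P (x t) u Hr Hc)).
  assert (Hcont : forall u, continuous (fun u => sixth_root_sqr (family_det x t u)) u).
  { intros u. apply (continuous_comp (family_det x t) sixth_root_sqr).
    - apply continuity_2d_pt_continuous_r, (continuity_2d_family_det x t0 delta); easy.
    - apply (ex_derive_continuous sixth_root_sqr); eexists; now apply is_derive_sixth_root_sqr. }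
  assert (E : RInt (fun u => Rpower (geodesic_curvature rho (x t) u) (1 / 3) * speed (x t) u) 0 P
    = / Rpower rho (1 / 3) * RInt (fun u => sixth_root_sqr (family_det x t u)) 0 P :> R).
  { rewrite <- (RInt_scal (fun u => sixth_root_sqr (family_det x t u)))
      by (apply (ex_RInt_continuous (fun u => sixth_root_sqr (family_det x t u))); auto).
    apply RInt_ext; intros u _. unfold scal; simpl; unfold mult; simpl.
    apply (Rmult_eq_reg_l (Rpower rho (1 / 3))); [|lra].
    rewrite (ec_density_det3 rho P) by easy.
    unfold sixth_root_sqr. rewrite <- Rmult_assoc, Rinv_r, Rmult_1_l by lra.
    reflexivity. }
  rewrite E. field; lra.
Qed.

(** The angles 2 pi s / L_e and theta are both proportional to s and both equal 2 pi after one turn,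
    so they coincide. *)
Lemma rotational_speed_turning (k P : R) (c : R -> vec3) (f : R -> R) :
  0 < k -> 0 < P -> turning k (speed c) P = 2 * PI ->
  (exists a b, forall u, f u = a * cos (turning k (speed c) u) + b * sin (turning k (speed c) u)) ->
  rotational_speed P c f.
Proof.
  intros Hk HP HT (a & b & H). exists a, b; intros u.
  rewrite H. assert (H3 : 0 < sqrt 3) by (apply sqrt_lt_R0; lra).
  assert (HPI := PI_RGT_0).
  replace (2 * PI * arclength c u / euclidean_length P c) with (turning k (speed c) u); [easy|].
  unfold euclidean_length; rewrite <- HT.
  unfold turning, arclength in *.
  assert (RInt (speed c) 0 P <> 0) by (intros E; rewrite E in HT; lra).
  simpl in *; field; easy.
Qed.

Theorem theorem3p3 (rho P : R) (c : R -> vec3)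
    (Hrho : 0 < rho)
    (Hclosed : closed_sphere_curve rho P c)
    (Hsimple : simple_curve P c)
    (Hkappa : forall u : R, geodesic_curvature rho c u = sqrt 2 / (2 * rho)) :
  ec_maximal rho P c.
Proof.
  assert (HP := csc_period_pos _ _ _ Hclosed).
  assert (F := constant_curvature_frenet rho P c Hrho Hclosed Hkappa).
  set (k := sqrt 2 / (2 * rho)) in *.
  assert (HT := simple_turning _ _ _ _ _ _ HP F Hsimple).
  split; [easy|split; [now exists k|]].
  intros t0 delta x W U [Hdelta Hinit Hsm Hcl Hvel] L.
  assert (Ht0 : Rabs (t0 - t0) < delta) by (rewrite Rminus_diag, Rabs_R0; easy).
  assert (Ec : x t0 = c) by (extensionality u; apply Hinit).
  assert (St := smooth_family_vDt _ _ _ Hsm). assert (Stt := smooth_family_vDt _ _ _ St).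
  assert (Px : forall t u, Rabs (t - t0) < delta -> x t (u + P) = x t u)
    by (intros t u Ht; apply (csc_periodic _ _ _ (Hcl t Ht))).
  assert (Pt : forall t u, Rabs (t - t0) < delta -> vDt x t (u + P) = vDt x t u)
    by (intros; now apply (vDt_periodic P t0 delta)).
  assert (Ptt : forall t u, Rabs (t - t0) < delta -> vDt (vDt x) t (u + P) = vDt (vDt x) t u)
    by (intros; now apply (vDt_periodic P t0 delta)).
  assert (Sy := vperiodic_smooth_slice P _ _ _ t0 St Ht0 (fun u => Pt t0 u Ht0)).
  assert (Sz := vperiodic_smooth_slice P _ _ _ t0 Stt Ht0 (fun u => Ptt t0 u Ht0)).
  pose proof F as [Hk Hv Sv Sc ST SE dc dT dE cc TT EE cT cE TE].
  set (T := tangent c) in *. set (E := unit_normal rho c) in *. set (v := speed c) in *.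
  assert (Ey : forall u, vDt x t0 u = lin3 (c u) (T u) (E u) 0 (W t0 u) (U t0 u)).
  { intros u. assert (G := Hvel t0 u Ht0). rewrite Ec in G.
    unfold vDt; rewrite G. unfold T, E; vec_ring. }
  (* Smoothness and periodicity of W and U at the initial time are recovered from the velocity, by
     projection on the frame. *)
  assert (EW : forall u, W t0 u = vdot (vDt x t0 u) (T u)).
  { intros u; rewrite Ey; unfold lin3; vdot_expand.
    rewrite (vdot_sym (E u)), cT, TT, TE; ring. }
  assert (EU : forall u, U t0 u = vdot (vDt x t0 u) (E u)).
  { intros u; rewrite Ey; unfold lin3; vdot_expand. rewrite cE, EE, TE; ring. }
  assert (SW : periodic_smooth P (W t0)).
  { replace (W t0) with (fun u => vdot (vDt x t0 u) (T u)) by (extensionality u; now rewrite EW).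
    now apply periodic_smooth_vdot. }
  assert (SU : periodic_smooth P (U t0)).
  { replace (U t0) with (fun u => vdot (vDt x t0 u) (E u)) by (extensionality u; now rewrite EU).
    now apply periodic_smooth_vdot. }
  set (f := fun u => 2 * k ^ 2 * vdot (vDt (vDt x) t0 u) (c u)).
  set (b := fun u => vdot (vDt (vDt x) t0 u) (T u)).
  set (e := fun u => vdot (vDt (vDt x) t0 u) (E u)).
  assert (Sb : periodic_smooth P b) by now apply periodic_smooth_vdot.
  assert (Se : periodic_smooth P e) by now apply periodic_smooth_vdot.
  assert (Sf : periodic_smooth P f).
  { apply periodic_smooth_mult; [apply periodic_smooth_const | now apply periodic_smooth_vdot]. }
  assert (Ez : forall u, vDt (vDt x) t0 u = lin3 (c u) (T u) (E u) (f u) (b u) (e u))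
    by (intros u; now apply orthogonal_decomposition).
  assert (Ef : forall u, f u = - (2 * k ^ 2) * (W t0 u ^ 2 + U t0 u ^ 2)).
  { intros u. assert (G := family_velocity_dots rho x t0 delta u Hdelta Hsm).
    rewrite Ec in G. unfold f; rewrite G.
    - rewrite Ey; unfold lin3; vdot_expand.
      rewrite (vdot_sym (T u) (c u)), (vdot_sym (E u) (c u)), (vdot_sym (E u) (T u)),
        cT, cE, TE, TT, EE; ring.
    - intros t Ht. apply (sphere_curve_dots rho P (x t) u (Hcl t Ht)). }
  destruct (second_variation_density k P v c T E (W t0) (U t0) f b e F SW SU Sf Sb Se Ef)
    as (G1 & G2 & SG1 & SG2 & HD0 & HG1 & HG2).
  (* The initial density is C v with C constant, because the curvature is; C therefore leaves the
     integrals, and total derivatives integrate to zero over a period. *)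
  set (C := Rpower rho (1 / 3) * Rpower k (1 / 3)).
  assert (HC : 0 < C) by (apply Rmult_lt_0_compat; apply exp_pos).
  assert (Fy : vDt x t0 = fun u => lin3 (c u) (T u) (E u) 0 (W t0 u) (U t0 u))
    by (extensionality u; apply Ey).
  assert (Fz : vDt (vDt x) t0 = fun u => lin3 (c u) (T u) (E u) (f u) (b u) (e u))
    by (extensionality u; apply Ez).
  assert (EF : forall u, sixth_root_sqr (family_det x t0 u) = C * v u).
  { intros u. unfold sixth_root_sqr, family_det, vDu. rewrite Ec.
    rewrite <- (ec_density_det3 rho P) by easy. rewrite Hkappa. unfold C, v; ring. }
  assert (ED1 : forall u, family_det_t x t0 u = det3_d1 (c u) (vDerive c u) (vDerive (vDerive c) u)
    (vDt x t0 u) (vDerive (vDt x t0) u) (vDerive (vDerive (vDt x t0)) u)).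
  { intros u; unfold family_det_t.
    rewrite (vDt_vDu t0 delta), (vDt_vDu_vDu t0 delta) by easy.
    unfold vDu; now rewrite Ec. }
  assert (ED2 : forall u, family_det_tt x t0 u = det3_d1 (c u) (vDerive c u) (vDerive (vDerive c) u)
    (vDt (vDt x) t0 u) (vDerive (vDt (vDt x) t0) u) (vDerive (vDerive (vDt (vDt x) t0)) u)
    + det3_d2 (c u) (vDerive c u) (vDerive (vDerive c) u)
    (vDt x t0 u) (vDerive (vDt x t0) u) (vDerive (vDerive (vDt x t0)) u)).
  { intros u; unfold family_det_tt.
    rewrite (vDt_vDt_vDu t0 delta), (vDt_vDt_vDu_vDu t0 delta),
      (vDt_vDu t0 delta), (vDt_vDu_vDu t0 delta) by easy.
    unfold vDu; now rewrite Ec. }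
  assert (ED0 : forall u, family_det x t0 u = det3 (c u) (vDerive c u) (vDerive (vDerive c) u))
    by (intros u; unfold family_det, vDu; now rewrite Ec).
  assert (Hnz : forall t u, Rabs (t - t0) < delta -> family_det x t u <> 0)
    by (intros t u Ht; exact (closed_sphere_curve_det3_neq0 rho P (x t) u Hrho (Hcl t Ht))).
  destruct (sixth_root_integral_derivatives (family_det x) (family_det_t x) (family_det_tt x)
    t0 delta P Hdelta Hnz) as [HL1 HL2];
    try (intros; now apply (is_derive_family_det x t0 delta));
    try (intros; now apply (continuity_2d_family_det x t0 delta)).
  (* The agreement is stated around every time of the strip: [is_derive_n] at order 2 needs the
     first derivative of L on a neighbourhood of t0. *)
  assert (HLloc : forall t, Rabs (t - t0) < delta -> locally t (fun t' =>
      RInt (fun u => sixth_root_sqr (family_det x t' u)) 0 P = L t')).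
  { intros t Ht. apply (filter_imp (fun t' => Rabs (t' - t0) < delta)); [|now apply locally_strip].
    intros t' Ht'. symmetry. apply (ec_length_family_det rho P t0 delta); auto. }
  assert (HL : forall t, Rabs (t - t0) < delta -> is_derive L t
      (RInt (fun u => sixth_root_sqr (family_det x t u)
         * (family_det_t x t u / (3 * family_det x t u))) 0 P)).
  { intros t Ht. apply (is_derive_ext_loc _ _ _ _ (HLloc t Ht)). now apply HL1. }
  split.
  - evar_last; [now apply HL|].
    assert (Z := RInt_Derive_periodic P G1 0 SG1). rewrite Rplus_0_l in Z.
    transitivity (RInt (fun u => C * Derive G1 u) 0 P).
    + apply RInt_ext; intros u _. rewrite EF, ED1, ED0, Fy.
      rewrite <- HG1. simpl; ring.
    + rewrite RInt_scal_smooth by apply smooth_Derive, SG1. rewrite Z; simpl; ring.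
  - intros Hnr. split.
    + apply (filter_imp (fun t => Rabs (t - t0) < delta)); [|now apply locally_strip].
      intros t Ht; eexists; now apply HL.
    + eexists; split.
      * simpl. apply (is_derive_ext_loc _ _ _ _) with (2 := HL2).
        apply (filter_imp (fun t => Rabs (t - t0) < delta)); [|now apply locally_strip].
        intros t Ht. symmetry. apply is_derive_unique. now apply HL.
      * destruct (index_form_positive k P v (U t0) HP Hk Hv Sv HT SU) as [Hrot|Hpos].
        { exfalso; apply Hnr. now apply (rotational_speed_turning k). }
        match type of Hpos with 0 < RInt ?q 0 P => set (Q := q) in * end.
        assert (SQ : smooth Q).
        { apply smooth_mult; [apply Sv|].
          assert (D1 := periodic_smooth_d_speed P v _ Hv Sv SU).
          assert (D2 := periodic_smooth_d_speed P v _ Hv Sv D1).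
          refine (proj1 (_ : periodic_smooth P _)). psmooth. }
        assert (Z := RInt_Derive_periodic P G2 0 SG2). rewrite Rplus_0_l in Z.
        (* The total derivative of G2 contributes nothing over a period, so the sign is that of
           minus the integral of Q, which is positive once rotational speeds are excluded. *)
        match goal with |- ?I < 0 =>
          replace I with (RInt (fun u => C * Derive G2 u + - (C * (2 / (9 * k ^ 2))) * Q u) 0 P) end.
        { assert (SD := smooth_Derive _ (proj1 SG2)).
          rewrite RInt_plus_smooth, !RInt_scal_smooth, Z by smooth_tac.
          assert (0 < C * (2 / (9 * k ^ 2))).
          { apply Rmult_lt_0_compat; [easy|]. apply Rdiv_lt_0_compat; nra. }
          simpl in *; nra. }
        apply RInt_ext; intros u _. rewrite EF, ED1, ED2, ED0, Fy, Fz.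
        unfold Q. specialize (HG2 u). cbv zeta beta in HG2.
        transitivity (C * (Derive G2 u - 2 / (9 * k ^ 2) * (v u * (d_speed v (d_speed v (U t0)) u ^ 2
          - 9 * k ^ 2 * d_speed v (U t0) u ^ 2 + 18 * k ^ 4 * U t0 u ^ 2)))); [simpl; ring|].
        rewrite <- HG2. simpl; ring.
Qed.
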